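(* Let $d>1$ be an odd square-free integer, let $m$ be a positive even integer, let $f=\max_{p\mid d}f_p$, and let $\tau(d)$ be the number of distinct prime divisors of $d$. Put $$n_d=\lceil f+\log_2(\tau(d))+2\rceil .$$ Then for all integers $n\ge n_d$, $$\mathrm{ord}_2\big(L(\chi_n\psi_d,1-m)\big)=1+2^{1-n}\Big(-1+\sum_{p\mid d}2^{f_p}\Big).$$
   Context: $\mathbb{Q}_n$ is the $n$-th layer of the cyclotomic $\mathbb{Z}_2$-extension of $\mathbb{Q}$. For $n\ge1$, $\chi_n$ is a primitive character of $\mathrm{Gal}(\mathbb{Q}_n/\mathbb{Q})$ (i.e. one of order $2^n$), viewed as an even primitive Dirichlet character modulo $2^{n+2}$. $\psi_d$ is the Dirichlet character associated to $\mathbb{Q}(\sqrt d)/\mathbb{Q}$. $L(\rho,s)$ is the Dirichlet $L$-function of $\rho$. For an odd prime $p$, $p^*=\left(\frac{-1}{p}\right)p$ and $f_p=\mathrm{ord}_2\left(\frac{p^*-1}{4}\right)$; $p$ ranges over prime divisors of $d$. $\lceil x\rceil=\min\{n\in\mathbb{Z}:n\ge x\}$. $\mathrm{ord}_2$ is a fixed $2$-adic valuation on $\overline{\mathbb{Q}}$ with $\mathrm{ord}_2(2)=1$. *)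

(* Defs.v *)
From HB Require Import structures.
From mathcomp Require Export all_boot all_order all_algebra all_field.
From mathcomp Require Export complex.
From mathcomp Require Export all_classical all_reals all_analysis.

Set Implicit Arguments.
Unset Strict Implicit.
Unset Printing Implicit Defensive.

Import Order.TTheory GRing.Theory Num.Theory numFieldNormedType.Exports.

Local Open Scope classical_set_scope.
Local Open Scope complex_scope.
Local Open Scope ring_scope.

Definition squarefree (d : nat) : Prop :=
  forall p : nat, prime p -> ~~ (p ^ 2 %| d)%N.

Definition legendre (a : int) (p : nat) : int :=
  if (p %| a)%Z then 0
  else if [exists x : 'I_p, ((x : nat)%:Z ^+ 2 == a %[mod p])%Z] then 1 else -1.

(* p* = (-1/p) p, for an odd prime p *)
Definition pstar (p : nat) : int := legendre (-1) p * p%:Z.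

(* f_p = ord_2((p* - 1)/4); since p* = 1 mod 4 the division is exact *)
Definition fexp (p : nat) : nat := logn 2 `|((pstar p - 1) %/ 4)%Z|.

Definition fmax (d : nat) : nat := (\max_(p <- primes d) fexp p)%N.

(* ceil (f + log_2 (tau d) + 2) *)
Definition nbound (R : realType) (d : nat) : int :=
  Num.ceil ((fmax d)%:R + ln ((size (primes d))%:R : R) / ln 2 + 2).

(* Dirichlet characters are functions on the integers, with values in the field
   of algebraic numbers, extended by 0 off the units modulo N. *)
Definition dirichlet_character (N : nat) (chi : int -> algC) : Prop :=
  [/\ forall a b : int, (a = b %[mod N])%Z -> chi a = chi b,
      chi 1 = 1,
      {morph chi : a b / a * b}
    & forall a : int, (chi a != 0) = coprimez a N].

Definition primitive_character (N : nat) (chi : int -> algC) : Prop :=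
  forall M : nat, (M %| N)%N -> (M < N)%N ->
  ~ (forall a b : int, coprimez a N -> coprimez b N ->
       (a = b %[mod M])%Z -> chi a = chi b).

Definition character_order (N : nat) (chi : int -> algC) (e : nat) : Prop :=
  forall k : nat,
    (forall a : int, coprimez a N -> chi a ^+ k = 1) <-> (e %| k)%N.

(* Q_n is the maximal real subfield of Q(zeta_(2^(n+2))), so the characters of
   Gal(Q_n/Q) = (Z/2^(n+2))^* / {1, -1} are the even Dirichlet characters
   modulo 2^(n+2).  For n >= 1, such a character has order 2^n if and only if
   it is primitive modulo 2^(n+2). *)
Definition cyclotomic_layer_character (n : nat) (chi : int -> algC) : Prop :=
  [/\ dirichlet_character (2 ^ n.+2) chi,
      chi (-1) = 1,
      primitive_character (2 ^ n.+2) chi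
    & character_order (2 ^ n.+2) chi (2 ^ n)].

(* discriminant of Q(sqrt d), for d > 1 square-free *)
Definition quadratic_disc (d : nat) : nat :=
  if (d %% 4 == 1)%N then d else (4 * d)%N.

(* for a prime q not dividing the discriminant *)
Definition splits_in_quadratic (d q : nat) : bool :=
  if q == 2%N then (d %% 8 == 1)%N else legendre d%:Z q == 1.

(* The character of Q(sqrt d)/Q: it is 1, -1 or 0 at a prime according as the
   prime splits, is inert or ramifies (the value 0 is in dirichlet_character).
   By multiplicativity and periodicity this determines psi. *)
Definition quadratic_field_character (d : nat) (psi : int -> algC) : Prop :=
  dirichlet_character (quadratic_disc d) psi /\
  forall q : nat, prime q -> ~~ (q %| quadratic_disc d)%N ->
    psi q%:Z = if splits_in_quadratic d q then 1 else -1.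

Definition cexp (R : realType) (z : R[i]) : R[i] :=
  (expR (complex.Re z) * cos (complex.Im z))
    +i* (expR (complex.Re z) * sin (complex.Im z)).

(* k ^ s, for k > 0 *)
Definition natpowC (R : realType) (k : nat) (s : R[i]) : R[i] :=
  cexp (s * (ln (k%:R : R))%:C).

(* The regular module R[i]^o carries the topology of the complex plane. *)
Definition entire (R : realType) (L : R[i] -> R[i]) : Prop :=
  forall s0 : R[i], exists2 r : R, 0 < r &
  exists a : nat -> R[i], forall s : R[i], `|s - s0| < r%:C ->
    series (fun k => a k * (s - s0) ^+ k : R[i]^o) @ \oo --> (L s : R[i]^o).

(* L is the Dirichlet L-function of rho: the analytic continuation to the plane
   of the Dirichlet series.  For nonprincipal rho it has no pole at s = 1. *)
Definition dirichlet_L_function (R : realType) (rho : int -> R[i])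
    (L : R[i] -> R[i]) : Prop :=
  entire L /\
  forall s : R[i], 1 < complex.Re s ->
    series (fun k => rho k.+1%:Z * natpowC k.+1 (- s) : R[i]^o) @ \oo
      --> (L s : R[i]^o).

(* 2-adic valuation on the algebraic numbers, normalized by v 2 = 1 *)
Definition two_adic_valuation (R : realType) (v : algC -> \bar R) : Prop :=
  [/\ forall x : algC, v x = +oo%E <-> x = 0,
      forall x : algC, v x <> -oo%E,
      forall x y : algC, v (x * y) = (v x + v y)%E,
      forall x y : algC, (Order.min (v x) (v y) <= v (x + y)%R)%E
    & v 2 = 1%E].

(* Main.v *)
Require Import Defs.
Import Order.TTheory GRing.Theory Num.Theory numFieldNormedType.Exports.
From mathcomp Require Import ring lra zify.
Local Open Scope complex_scope.
Local Open Scope ring_scope.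

Set Implicit Arguments.
Unset Strict Implicit.
Unset Printing Implicit Defensive.

(** Write g = chi psi, H = 2^n d and M = m - 1, which is odd.  Since chi is
primitive modulo 2^(n+2), chi(1 + 2^(n+1)) = -1, so g changes sign under
translation by 2 H.  This antiperiodicity carries both halves of the argument.

Analytic half.  For an antiperiodic g and a function w on the positive reals,
replacing w(t) by the difference w(t) - w(t + 2H) doubles the sum of g(k) w(k)
up to finitely many terms.  Applied J times to t^(-s), with J larger than
M + 3, this expresses 2^J L(s) through a finite sum of exponentials and a
series of J-th differences, which converges for real s > -M - 1.  Expanding
that series in powers of s - s0 (the J-th differences of the Taylor
coefficients of t^(-s) are bounded by a constant times t^(1-s0-J), uniformly in
the degree) shows that it is real-analytic, so the identity persists from
s > 1 down to s = -M, where the J-th differences of t^M vanish.  Hence L(-M)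
is the finite expression [regularized_sum]: with Delta = 1 - E, where E is the
translation by 2H, it expands the inverse of 1 + E as the sum of
Delta^i / 2^(i+1) and applies it to t^M ([L_value_antiperiodic]).

Arithmetic half.  Applying the functional equation of [regularized_sum] to
(t - H)^M shows that L(-M) is congruent modulo 2^n to the sum U(g) of
g(k) k^M over 0 <= k < H ([regularized_sum_congruence]).  It remains to find
the valuation of U(g), which turns out to be smaller than 2.

- Let g1 be chi restricted to the integers prime to d.  The values of g - g1
are divisible by 2.  For c = 4 d + 1, multiplication by c permutes the
integers in [0, H) up to sign and multiples of 2H, as in the lemma of Gauss;
comparing U with itself along this permutation shows that
(1 - chi(c) c^m) (U(g) - U(g1)) is divisible by 4 ([half_sum_twist]).
- Removing the multiples of one prime p multiplies U by 1 - chi(p) p^M modulo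
2^n ([half_sum_euler_factor]), so U(g1) is the product of these factors over
p | d times the sum U(chi) over [0, 2^n).
- Because p* = 1 + 2^(f_p + 2) w with w odd and p* = p or - p, chi(p) is a root
of unity of exact order 2^(n - f_p), and 1 - chi(p) p^M has valuation
2^(1 - n + f_p) ([v_euler_factor]).
- U(chi) is congruent modulo 2 to the sum of chi(k) over 0 <= k < 2^n, which
has valuation 1 - 2^(1-n) ([v_sum_chi]): multiplied by 1 - chi(5) it becomes,
up to sign, twice the sum of an odd number of roots of unity of 2-power order,
again by the permutation argument.

The bound on n implies that the sum of the 2^(1 - n + f_p) is at most 1/2, which
keeps all these valuations below the valuations of the error terms. *)

(** * Dominated series and interchange of double sums *)

Section Series.
Local Open Scope classical_set_scope.
Variable R : realType.
Implicit Types (u M : R^nat).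

Lemma series_majorized_cvg u M :
  cvgn (series M) -> (forall k, `|u k| <= M k) -> cvgn (series u).
Proof.
move=> cM uM; apply: (@normed_cvg R R^o).
apply: series_le_cvg cM => // k.
  exact: normr_ge0.
by move: (uM k); apply: le_trans.
Qed.

Lemma lim_series_le u N e : cvgn (series u) ->
    (forall n, (N <= n)%N -> `|series u n| <= e) -> `|limn (series u)| <= e.
Proof.
move=> cu H; rewrite ler_norml; apply/andP; split.
  by apply: limr_ge => //; near=> n; have /H : (N <= n)%N by [near: n; exists N]; rewrite ler_norml => /andP[].
by apply: limr_le => //; near=> n; have /H : (N <= n)%N by [near: n; exists N]; rewrite ler_norml => /andP[].
Unshelve. all: by end_near. Qed.

Lemma cvg_sum_seq I (r : seq I) (F : I -> R^nat) (l : I -> R) :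
  (forall i, F i @ \oo --> l i) ->
  (fun N => \sum_(i <- r) F i N) @ \oo --> \sum_(i <- r) l i.
Proof.
move=> H; elim: r => [|i r IH].
  by rewrite big_nil; under eq_fun do rewrite big_nil; exact: cvg_cst.
rewrite big_cons; under eq_fun do rewrite big_cons.
exact: cvgD (H i) IH.
Qed.

(** The dominated convergence theorem for series: beyond an index K the tail of
the dominating series controls everything, and the finitely many terms before K
converge. *)
Lemma series_dominated (a : nat -> R^nat) (A : R^nat) M :
  cvgn (series M) -> (forall k N, `|a k N| <= M k) ->
  (forall k, a k @ \oo --> A k) ->
  (fun N => limn (series (a^~ N))) @ \oo --> limn (series A).
Proof.
move=> cM aM aA.
have AM k : `|A k| <= M k.
  have /cvg_norm h := aA k; rewrite -(cvg_lim _ h)//.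
  apply: limr_le; first by apply/cvg_ex; exists `|A k|.
  by near=> n; exact: aM.
have cA := series_majorized_cvg cM AM.
have ca N := series_majorized_cvg cM (aM^~ N).
have M0 k : 0 <= M k by move: (AM k); apply: le_trans.
apply/cvgrPdist_le => e e0.
have /cvgrPdist_le/(_ (e / 8)) := cM.
have e40 : 0 < e / 8 by lra.
move=> /(_ e40)[K _ HK].
have /cvgrPdist_le/(_ (e / 8) e40) :
    (fun N => \sum_(k <- iota 0 K) `|A k - a k N|) @ \oo --> \sum_(k <- iota 0 K) (0 : R).
  apply: cvg_sum_seq => k; rewrite -(normr0 R) -(subrr (A k)).
  by apply: cvg_norm; apply: cvgB => //; exact: cvg_cst.
rewrite big1// => hK.
near=> N.
have hKN : \sum_(k <- iota 0 K) `|A k - a k N| <= e / 8.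
  have : `|0 - \sum_(k <- iota 0 K) `|A k - a k N| | <= e / 8.
    by near: N.
  by rewrite sub0r normrN ger0_norm// sumr_ge0.
rewrite -lim_seriesB//.
apply: (@lim_series_le _ K); first exact: is_cvg_seriesB.
move=> n Kn; rewrite /series/= (big_cat_nat (leq0n K) Kn)/=.
apply: le_trans (ler_normD _ _) _.
have h1 : `|\sum_(0 <= i < K) (A i - a i N)| <= e / 8.
  apply: le_trans (ler_norm_sum _ _ _) _.
  by rewrite /index_iota subn0.
have h2 : `|\sum_(K <= i < n) (A i - a i N)| <= 2 * (series M n - series M K).
  rewrite sub_series_geq// mulr_sumr.
  apply: le_trans (ler_norm_sum _ _ _) _; apply: ler_sum => i _.
  apply: le_trans (ler_normB _ _) _.
  by have := AM i; have := aM i N; lra.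
have h3 : series M n - series M K <= e / 8 + e / 8.
  have := HK n Kn; have := HK K (leqnn K); rewrite /mkset.
  move: (limn _) (series M n) (series M K) => x y z.
  by rewrite !ler_norml => /andP[? ?] /andP[? ?]; lra.
apply: le_trans (lerD h1 h2) _.
by move: (_ - _) h3 => x h3; lra.
Unshelve. all: by end_near. Qed.

(** The partial sums of the k-th row are dominated by M k / (1 - q), so that
dominated convergence applies to the sequence of partial row sums. *)
Lemma double_series_swap (a : nat -> nat -> R) (A M : R^nat) (q : R) :
  0 <= q < 1 -> cvgn (series M) -> (forall k j, `|a k j| <= M k * q ^+ j) ->
  (forall k, series (a k) @ \oo --> A k) ->
  series (fun j => limn (series (a^~ j))) @ \oo --> limn (series A).
Proof.
move=> /andP[q0 q1] cM aM aA.
have M0 k : 0 <= M k by have := aM k 0%N; rewrite expr0 mulr1; apply: le_trans.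
have q1' : 0 < 1 - q by lra.
have bnd k N : `|series (a k) N| <= M k / (1 - q).
  apply: le_trans (ler_norm_sum _ _ _) _.
  apply: (@le_trans _ _ (series (geometric (M k) q) N)).
    by apply: ler_sum => j _; exact: aM.
  rewrite geometric_seriesE ?lt_eqF//.
  rewrite ler_pM2r ?invr_gt0// ler_piMr// gerBl exprn_ge0//.
have cM' : cvgn (series (fun k => M k / (1 - q))).
  have -> : (fun k => M k / (1 - q)) = ((1 - q)^-1 *: M) by apply/funext => k; rewrite mulrC.
  exact: is_cvg_seriesZ.
have := series_dominated cM' bnd aA.
suff -> : (fun N => limn (series (fun k => series (a k) N))) =
          series (fun j => limn (series (a^~ j))) by [].
apply/funext => N.
have caj j : cvgn (series (a^~ j)).
  apply: (@series_majorized_cvg _ M cM) => k; apply: le_trans (aM k j) _.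
  by rewrite ler_piMr// exprn_ile1 ?(ltW q1).
elim: N => [|N IH].
  rewrite /series/= big_geq//; apply/cvg_lim => //.
  by under eq_fun do under eq_bigr do rewrite big_geq//; under eq_fun do rewrite big1//; exact: cvg_cst.
rewrite seriesSr -IH -lim_seriesD//; last first.
  exact: (series_majorized_cvg cM' (bnd^~ N)).
congr (limn (series _)); apply/funext => k.
by rewrite fctE seriesSr.
Qed.
End Series.

(** * Uniqueness of real-analytic continuation *)

Section Identity.
Local Open Scope classical_set_scope.
Variable R : realType.

(** Real-analyticity at a point, with an explicit radius. *)
Definition power_series_at (h : R -> R) (x0 : R) :=
  exists2 r : R, 0 < r & exists a : R^nat, forall x, `|x - x0| < r ->
    series (fun k => a k * (x - x0) ^+ k) @ \oo --> h x.

(** Let k be the least index with a nonzero coefficient.  Convergence at one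
positive point rho bounds the coefficients geometrically, so the terms after
the k-th are O(y^(k+1)) as y tends to 0 and cannot cancel a k y^k. *)
Lemma power_series_eq0 (a : R^nat) (dlt : R) : 0 < dlt ->
  (forall y : R, 0 < y < dlt -> series (fun k => a k * y ^+ k) @ \oo --> (0 : R)) ->
  forall k, a k = 0.
Proof.
move=> d0 H; elim/ltn_ind => k IH.
have [rho /andP[rho0 rhod]] : exists rho, 0 < rho < dlt by exists (dlt / 2); lra.
have crho : series (fun k => a k * rho ^+ k) @ \oo --> (0 : R) by apply: H; rewrite rho0.
have [B HB] : exists B : R, forall j, `|a j * rho ^+ j| <= B.
  have : cvgn (series (fun k => a k * rho ^+ k)) by apply/cvg_ex; exists 0.
  move/cvg_series_bounded => [M [_ HM]]; exists (M + 1) => j.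
  by apply: HM => //; rewrite ltrDl.
have B0 : 0 <= B by move: (HB 0%N); apply: le_trans.
have tail (q : R) n : 0 <= q <= 2^-1 -> \sum_(k.+1 <= j < k.+1 + n) q ^+ j <= 2 * (q ^+ k.+1 - q ^+ (k.+1 + n)).
  move=> /andP[q0 q2]; elim: n => [|n IHn].
    by rewrite addn0 big_geq// subrr mulr0.
  rewrite addnS big_nat_recr ?leq_addr//= [q ^+ (_ + n).+1]exprS.
  have : 0 <= q ^+ (k.+1 + n) by rewrite exprn_ge0.
  have : q * q ^+ (k.+1 + n) <= 2^-1 * q ^+ (k.+1 + n) by rewrite ler_wpM2r// exprn_ge0.
  by move: IHn; lra.
have key (y : R) : 0 < y < rho / 2 -> `|a k| <= 2 * B / rho ^+ k.+1 * y.
  move=> /andP[y0 yr].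
  have yd : 0 < y < dlt by rewrite y0/=; lra.
  pose q := y / rho.
  have q01 : 0 <= q <= 2^-1.
    rewrite /q; apply/andP; split; first by rewrite divr_ge0 ?ltW.
    by rewrite ler_pdivrMr//; lra.
  have : `|a k * y ^+ k| <= 2 * B * q ^+ k.+1.
    have -> : a k * y ^+ k = limn (fun n => a k * y ^+ k - series (fun k => a k * y ^+ k) n).
      apply/esym/cvg_lim => //.
      have -> : a k * y ^+ k = a k * y ^+ k - 0 by rewrite subr0.
      by rewrite subr0; rewrite -[X in _ --> X]subr0; apply: cvgB; [exact: cvg_cst|exact: H].
    set u := (fun n => _).
    have cu : cvgn u.
      apply/cvg_ex; exists (a k * y ^+ k - 0); apply: cvgB; [exact: cvg_cst|exact: H].
    rewrite -lim_norm//; apply: limr_le; first exact: is_cvg_norm.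
    near=> N.
    have kN : (k.+1 <= N)%N by near: N; exists k.+1.
    rewrite /u /series/= (big_cat_nat (leq0n k.+1) kN)/= big_nat_recr//=.
    rewrite big_nat big1 ?add0r; last by move=> i /andP[_ ik]; rewrite IH// mul0r.
    rewrite opprD addrA subrr add0r normrN.
    apply: le_trans (ler_norm_sum _ _ _) _.
    apply: (@le_trans _ _ (B * \sum_(k.+1 <= j < N) q ^+ j)).
      rewrite mulr_sumr; apply: ler_sum => j _.
      have -> : a j * y ^+ j = a j * rho ^+ j * q ^+ j.
        have rj : rho ^+ j != 0 by rewrite expf_neq0// gt_eqF.
        by rewrite /q expr_div_n; field.
      rewrite normrM [`|q ^+ j|]ger0_norm ?exprn_ge0//; last by case/andP: q01.
      by rewrite ler_wpM2r// exprn_ge0//; case/andP: q01.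
    rewrite [2 * B]mulrC -mulrA ler_wpM2l//.
    rewrite -(subnKC kN); apply: le_trans (tail q _ q01) _.
    by rewrite ler_wpM2l// gerBl exprn_ge0//; case/andP: q01.
  have yk : 0 < y ^+ k by rewrite exprn_gt0.
  rewrite normrM [`|y ^+ k|]ger0_norm ?(ltW yk)// -ler_pdivlMr//.
  move/le_trans; apply; rewrite le_eqVlt; apply/orP; left; apply/eqP.
  rewrite /q exprMn exprVn [y ^+ k.+1]exprS; field.
  by rewrite !expf_neq0 ?gt_eqF.
apply/eqP; rewrite -normr_le0; apply/ler_addgt0Pl => e e0; rewrite addr0.
pose C := 2 * B / rho ^+ k.+1.
have C0 : 0 <= C by rewrite /C !mulr_ge0// invr_ge0 exprn_ge0// ltW.
pose y := Num.min (rho / 4) (e / (C + 1)).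
have y0 : 0 < y by rewrite lt_min !divr_gt0//; lra.
have yr : 0 < y < rho / 2.
  by rewrite y0/=; apply: (@le_lt_trans _ _ (rho / 4)); [rewrite ge_min lexx|lra].
apply: le_trans (key y yr) _; rewrite -/C.
apply: (@le_trans _ _ ((C + 1) * (e / (C + 1)))).
  apply: ler_pM => //; [exact: ltW|by lra|by rewrite ge_min lexx orbT].
by rewrite mulrC divfK// gt_eqF//; lra.
Unshelve. all: by end_near. Qed.

(** At the supremum s of the points where h does not vanish, the expansion of h
vanishes to the right of s, hence on a whole neighbourhood of s, which
contradicts the choice of s. *)
Lemma identity_theorem (h : R -> R) (A B : R) :
  (forall x, A < x -> power_series_at h x) ->
  (forall x, B < x -> h x = 0) -> forall x, A < x -> h x = 0.
Proof.
move=> hA hB x1 Ax1; apply: contrapT => /eqP hx1.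
pose S := [set x | A < x /\ h x != 0].
have S1 : S x1 by [].
have ubS : has_ubound S.
  exists B => x [_ hx]; rewrite leNgt; apply/negP => /hB hx0.
  by rewrite hx0 eqxx in hx.
have supS : has_sup S by split => //; exists x1.
pose s := sup S.
have hs x : s < x -> h x = 0.
  move=> sx; apply: contrapT => /eqP hx.
  have [Ax|xA] := ltP A x.
    have : x <= s by apply: ub_le_sup.
    by rewrite leNgt sx.
  have : x1 <= s by apply: ub_le_sup.
  by move: sx xA Ax1; lra.
have As : A < s by apply: lt_le_trans Ax1 _; apply: ub_le_sup.
have [r r0 [a Ha]] := hA s As.
have a0 : forall k, a k = 0.
  apply: (power_series_eq0 r0) => y /andP[y0 yr].
  have := Ha (s + y); rewrite (_ : s + y - s = y) ?(ger0_norm (ltW y0)); last by ring.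
  move=> /(_ yr).
  by rewrite hs//; lra.
have hr x : `|x - s| < r -> h x = 0.
  move=> /Ha; have -> : (fun k => a k * (x - s) ^+ k) = fun=> 0.
    by apply/funext => k; rewrite a0 mul0r.
  move/cvg_lim => <- //; apply/cvg_lim => //.
  have -> : series (fun _ : nat => (0 : R)) = fun=> 0.
    by apply/funext => n; rewrite /series/= big1.
  exact: cvg_cst.
have [x Sx xs] := sup_adherent r0 supS.
have xs' : x <= s by apply: ub_le_sup.
rewrite -/s in xs; case: Sx => _ /eqP; apply; apply: hr.
by rewrite ler0_norm; lra.
Qed.

Lemma power_series_atD h1 h2 x0 :
  power_series_at h1 x0 -> power_series_at h2 x0 ->
  power_series_at (fun x => h1 x + h2 x) x0.
Proof.
move=> [r1 r10 [a1 H1]] [r2 r20 [a2 H2]].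
exists (Num.min r1 r2); first by rewrite lt_min r10.
exists (fun k => a1 k + a2 k) => x; rewrite lt_min => /andP[x1 x2].
have -> : series (fun k => (a1 k + a2 k) * (x - x0) ^+ k) =
   series (fun k => a1 k * (x - x0) ^+ k) + series (fun k => a2 k * (x - x0) ^+ k).
  by rewrite -seriesD; congr series; apply/funext => k; rewrite mulrDl.
by apply: cvgD; [exact: H1|exact: H2].
Qed.

Lemma power_series_atZ c h x0 :
  power_series_at h x0 -> power_series_at (fun x => c * h x) x0.
Proof.
move=> [r r0 [a H]]; exists r => //; exists (fun k => c * a k) => x /H Hx.
have -> : series (fun k => c * a k * (x - x0) ^+ k) =
   (fun n => c * series (fun k => a k * (x - x0) ^+ k) n).
  by apply/funext => n; rewrite /series/= mulr_sumr; apply: eq_bigr => i _; rewrite mulrA.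
by apply: cvgM => //; exact: cvg_cst.
Qed.

Lemma power_series_at_sum I (s : seq I) (h : I -> R -> R) x0 :
  (forall i, power_series_at (h i) x0) ->
  power_series_at (fun x => \sum_(i <- s) h i x) x0.
Proof.
move=> H; elim: s => [|i s IH].
  exists 1 => //; exists (fun=> 0) => x _; rewrite big_nil.
  have -> : series (fun k => 0 * (x - x0) ^+ k) = fun=> 0.
    by apply/funext => n; rewrite /series/= big1// => k _; rewrite mul0r.
  exact: cvg_cst.
by under eq_fun do rewrite big_cons; exact: power_series_atD.
Qed.
End Identity.

(** * Iterated differences of a negative power *)

Section Differences.
Local Open Scope classical_set_scope.
Variable R : realType.
Variable F : R.
Hypothesis F0 : 0 < F.
Implicit Types (w : R -> R) (t x : R).

Definition diff_step (w : R -> R) (t : R) : R := w t - w (t + F).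
Definition iter_diff (J : nat) (w : R -> R) : R -> R := iter J diff_step w.

Lemma iter_diff_lin J a b w1 w2 t :
  iter_diff J (fun t => a * w1 t + b * w2 t) t = a * iter_diff J w1 t + b * iter_diff J w2 t.
Proof. by elim: J t => [|J IH] t //=; rewrite /diff_step !IH; ring. Qed.

Lemma iter_diff_derive J w w' : (forall t, 0 < t -> is_derive t 1 w (w' t)) ->
  forall t, 0 < t -> is_derive t 1 (iter_diff J w) (iter_diff J w' t).
Proof.
move=> H; elim: J => [|J IH] t t0 /=; first exact: H.
have h : is_derive t 1 (iter_diff J w \o (fun s => s + F)) (iter_diff J w' (t + F) * 1).
  apply: is_derive1_comp; first by apply: IH; rewrite addr_gt0.
  by rewrite -[X in is_derive _ _ _ X]addr0; apply: is_deriveD.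
rewrite /diff_step; rewrite mulr1 in h.
exact: is_deriveB (IH t t0) h.
Qed.

(** The coefficient of y^j in the expansion of t^(-x-y) in powers of y. *)
Definition pow_taylor x (j : nat) t : R :=
  expR (- (x * ln t)) * ((- ln t) ^+ j / j`!%:R).

(** The exponential series of ln t gives (ln t)^j / j! <= t.  That the bound does
not depend on j makes the expansion converge absolutely for |y| < 1. *)
Lemma pow_taylor_bound x j t : 1 <= t -> `|pow_taylor x j t| <= expR ((1 - x) * ln t).
Proof.
move=> t1; have l0 : 0 <= ln t by rewrite ln_ge0.
rewrite normrM ger0_norm ?expR_ge0// normrM normrX normrN [`|ln t|]ger0_norm//.
rewrite normfV [`|_%:R|]ger0_norm//.
rewrite mulrBl mul1r addrC expRD ler_wpM2l ?expR_ge0//.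
case: j => [|j]; first by rewrite expr0 fact0 divr1 -expR0 ler_expR.
apply: le_trans (expR_ge1Dxn j l0); by rewrite lerDr.
Qed.

Lemma pow_taylor_derive x j t : 0 < t ->
  is_derive t 1 (pow_taylor x j)
   (- x * pow_taylor (x + 1) j t + (- 1) * (if j is i.+1 then pow_taylor (x + 1) i t else 0)).
Proof.
move=> t0.
have dl := is_derive1_ln t0.
have d1 : is_derive t 1 (expR \o (fun t => - (x * ln t))) (expR (- (x * ln t)) * (- (x * t^-1))).
  by apply: is_derive1_comp; exact: (is_deriveN (is_deriveZ x dl)).
have d2 : is_derive t 1 ((- (@ln R)) ^+ j) ((j%:R * (- ln t) ^+ j.-1) *: (- t^-1)).
  exact: (is_deriveX j (is_deriveN dl)).
have d3 := is_deriveM d1 (is_deriveZ (j`!%:R^-1) d2).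
rewrite (_ : pow_taylor x j = (expR \o (fun t => - (x * ln t))) *
    (j`!%:R^-1 \*: ((- (@ln R)) ^+ j))); last first.
  by apply/funext => s; rewrite /pow_taylor !fctE /= /GRing.scale/= [_ / _]mulrC.
apply: is_derive_eq d3 _.
have e1 : expR (- ((x + 1) * ln t)) = expR (- (x * ln t)) / t.
  by rewrite mulrDl mul1r opprD expRD [expR (- ln t)]expRN lnK.
rewrite /pow_taylor !e1 !fctE /= /GRing.scale /=.
have tn : t != 0 by rewrite gt_eqF.
case: j {d2} => [|j] /=; first by rewrite fact0 ?expr0 ?mul0r ?mulr0 ?mulr0n ?mul0r; field.
rewrite factS natrM.
have jn : (j.+1)%:R != 0 :> R by [].
have fn : (j`!)%:R != 0 :> R by rewrite pnatr_eq0 -lt0n fact_gt0.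
by rewrite exprS; field; rewrite fn tn addrC natr1.
Qed.

(** The mean value theorem evaluates a derivative at an unknown point of
[t, t + F]; powers of that point are comparable with powers of t. *)
Lemma expR_ln_shift e : exists2 C, 0 <= C &
  forall t s, 1 <= t -> t <= s -> s <= t + F -> expR (e * ln s) <= C * expR (e * ln t).
Proof.
exists (expR (`|e| * ln (1 + F))); first exact: expR_ge0.
move=> t s t1 ts sF; rewrite -expRD ler_expR.
have t0 : 0 < t by lra.
have s0 : 0 < s by lra.
have h1 : ln t <= ln s by rewrite ler_ln.
have h2 : ln s <= ln (1 + F) + ln t.
  have F1 : 0 < 1 + F by rewrite addr_gt0.
  rewrite -lnM// ler_ln ?posrE ?mulr_gt0//.
  apply: le_trans sF _; rewrite mulrDl mul1r lerD2l ler_peMr// ltW//.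
rewrite -lerBlDr -mulrBr; apply: le_trans (ler_norm _) _; rewrite normrM.
by rewrite ler_wpM2l// ger0_norm; lra.
Qed.

(** Each difference gains a factor 1/t.  By the mean value theorem it is F times
a derivative, and the derivative of the j-th coefficient for the exponent x is
a combination of the coefficients of index j and j - 1 for the exponent x + 1,
with factors bounded independently of j. *)
Lemma iter_diff_pow_taylor_bound J x : exists2 C, 0 <= C & forall j t, 1 <= t ->
  `|iter_diff J (pow_taylor x j) t| <= C * expR ((1 - x - J%:R) * ln t).
Proof.
elim: J x => [|J IH] x.
  by exists 1 => // j t t1; rewrite mul1r subr0; exact: pow_taylor_bound.
have [C C0 HC] := IH (x + 1).
have [D D0 HD] := expR_ln_shift (1 - (x + 1) - J%:R).
have [C' C'0 HC'] : exists2 C', 0 <= C' & forall j s, 1 <= s ->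
    `|iter_diff J (fun t => - x * pow_taylor (x + 1) j t + (- 1) * (if j is i.+1 then pow_taylor (x + 1) i t else 0)) s|
     <= C' * expR ((1 - (x + 1) - J%:R) * ln s).
  exists ((`|x| + 1) * C); first by rewrite mulr_ge0// addr_ge0.
  move=> j s s1; rewrite iter_diff_lin.
  apply: le_trans (ler_normD _ _) _; rewrite !normrM !normrN normr1 mul1r.
  rewrite mulrDl mul1r mulrDl -mulrA; apply: lerD.
    by rewrite ler_wpM2l//; exact: HC.
  case: j => [|i]; last exact: HC.
  have -> : iter_diff J (fun=> 0) s = 0.
    by elim: (J) s {s1} => // k IHk s /=; rewrite /diff_step !IHk subr0.
  by rewrite normr0 mulr_ge0// expR_ge0.
exists (F * (C' * D)); first by rewrite !mulr_ge0// ltW.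
move=> j t t1 /=.
have t0 : 0 < t by lra.
have dd := iter_diff_derive J (pow_taylor_derive x j).
have tF : t < t + F by rewrite ltrDl.
have [] := @MVT R (iter_diff J (pow_taylor x j)) (iter_diff J (fun t => - x * pow_taylor (x + 1) j t
    + (- 1) * (if j is i.+1 then pow_taylor (x + 1) i t else 0))) t (t + F) tF.
- by move=> s /[!in_itv]/= /andP[ts _]; apply: dd; lra.
- apply: derivable_within_continuous => s /[!in_itv]/= /andP[ts _].
  have s0 : 0 < s by lra.
  by have [] := dd s s0.
move=> c /[!in_itv]/= /andP[tc cF] Hc.
rewrite /diff_step -normrN opprB Hc addrAC subrr add0r normrM [`|F|]ger0_norm ?(ltW F0)//.
rewrite mulrC -(mulrA F) ler_pM2l// -mulrA.
have c1 : 1 <= c by lra.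
apply: le_trans (HC' j c c1) _; rewrite ler_wpM2l//.
have -> : 1 - x - J.+1%:R = 1 - (x + 1) - J%:R by rewrite -natr1; ring.
apply: HD => //; exact: ltW.
Qed.

Lemma expR_series (y : R) : series (fun j => y ^+ j / j`!%:R) @ \oo --> expR y.
Proof. exact: is_cvg_series_exp_coeff. Qed.

Lemma pow_taylor_series x0 x t :
  series (fun j => pow_taylor x0 j t * (x - x0) ^+ j) @ \oo --> expR (- (x * ln t)).
Proof.
have -> : - (x * ln t) = - (x0 * ln t) + - ((x - x0) * ln t) by ring.
rewrite expRD.
have -> : series (fun j => pow_taylor x0 j t * (x - x0) ^+ j) =
  (fun n => expR (- (x0 * ln t)) * series (fun j => (- ((x - x0) * ln t)) ^+ j / j`!%:R) n).
  apply/funext => n; rewrite /series/= mulr_sumr; apply: eq_bigr => j _.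
  by rewrite /pow_taylor -(mulrN (x - x0)) exprMn; ring.
by apply: cvgM; [exact: cvg_cst|exact: expR_series].
Qed.

Lemma iter_diff_pow_taylor_series J x0 x t :
  series (fun j => iter_diff J (pow_taylor x0 j) t * (x - x0) ^+ j) @ \oo -->
  iter_diff J (fun t => expR (- (x * ln t))) t.
Proof.
elim: J t => [|J IH] t /=; first exact: pow_taylor_series.
have -> : series (fun j => diff_step (iter_diff J (pow_taylor x0 j)) t * (x - x0) ^+ j) =
  series (fun j => iter_diff J (pow_taylor x0 j) t * (x - x0) ^+ j) -
  series (fun j => iter_diff J (pow_taylor x0 j) (t + F) * (x - x0) ^+ j).
  by rewrite -seriesN -seriesD; congr series; apply/funext => j; rewrite /diff_step !fctE mulrBl.
exact: cvgB (IH t) (IH (t + F)).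
Qed.
End Differences.

(** * Antiperiodic Dirichlet series at the nonpositive integers *)

(** The counterpart of [diff_step] on integral polynomials; the integrality is
what the 2-adic estimates rely on. *)
Definition Delta (F : nat) (P : {poly int}) : {poly int} :=
  P - (P \Po ('X + F%:Z%:P)).

Lemma DeltaE F P x : (Delta F P).[x] = P.[x] - P.[x + F%:Z].
Proof. by rewrite /Delta hornerD hornerN horner_comp !hornerE. Qed.

Lemma size_Delta F n (P : {poly int}) :
  (size P <= n.+1)%N -> (size (Delta F P) <= n)%N.
Proof.
move=> sP; have sX : size ('X + F%:Z%:P) = 2 by rewrite size_XaddC.
have sc : size (P \Po ('X + F%:Z%:P)) = size P by rewrite size_comp_poly2.
apply/leq_sizeP => j nj; rewrite coefB.
have [Pj|jP] := leqP (size P) j; first by rewrite !nth_default ?sc// subrr.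
have jE : j = (size P).-1 by lia.
have := lead_coef_comp P (q := 'X + F%:Z%:P); rewrite sX => /(_ isT).
by rewrite lead_coefXaddC expr1n mulr1 !lead_coefE sc -jE => ->; rewrite subrr.
Qed.

Lemma iter_Delta_eq0 F J (P : {poly int}) : (size P <= J)%N -> iter J (Delta F) P = 0.
Proof.
elim: J P => [|J IH] P; first by rewrite leqn0 size_poly_eq0 => /eqP.
by move=> sP; rewrite iterSr IH// size_Delta.
Qed.

Section Value.
Local Open Scope classical_set_scope.
Variable R : realType.

Lemma iter_diff_horner (w : R -> R) (P : {poly int}) F i :
  (forall s : nat, (0 < s)%N -> w s%:R = (P.[s%:Z])%:~R) ->
  forall s : nat, (0 < s)%N -> iter_diff F%:R i w s%:R = ((iter i (Delta F) P).[s%:Z])%:~R.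
Proof.
move=> H; elim: i => [|i IH] s s0 /=; first exact: H.
by rewrite /diff_step -natrD !IH ?addn_gt0 ?s0// DeltaE rmorphB.
Qed.

(** Comparison with the telescoping series of 2 (1/(k+1) - 1/(k+2)). *)
Lemma is_cvg_inv_square : cvgn (series (fun k => expR (- 2 * ln (k.+1%:R : R)))).
Proof.
pose v k : R := 2 * (harmonic k - harmonic k.+1).
have vE n : series v n = 2 * (1 - harmonic n).
  rewrite /series/= -mulr_sumr; congr (2 * _).
  elim: n => [|n IH]; first by rewrite big_geq// /= invr1 subrr.
  by rewrite big_nat_recr//= IH; ring.
have uv k : expR (- 2 * ln (k.+1%:R : R)) <= v k.
  have k0 : (0 : R) < k.+1%:R by [].
  have -> : expR (- 2 * ln (k.+1%:R : R)) = (k.+1%:R * k.+1%:R)^-1.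
    by rewrite mulNr expRN expRM_natl lnK.
  rewrite /v /=.
  have -> : (k.+1%:R)^-1 - (k.+2%:R)^-1 = ((k.+1%:R * k.+2%:R)^-1 : R).
    rewrite -[k.+2%:R]natr1; move: (k.+1%:R : R) k0 => b b0; field.
    by rewrite !gt_eqF// addr_gt0.
  rewrite -[_^-1]mul1r ler_pdivrMr ?mulr_gt0// mulrAC ler_pdivlMr ?mulr_gt0//.
  rewrite mul1r mulrA (mulrC 2) -!mulrA ler_pM2l// mulrC.
  by rewrite -natrM ler_nat; lia.
apply: (@series_le_cvg _ _ v) => //; do ?[by move=> n; exact: expR_ge0].
  by move=> n; apply: le_trans (uv n); exact: expR_ge0.
apply/cvg_ex; exists (2 * (1 - 0)); rewrite (_ : series v = fun n => 2 * (1 - harmonic n)); last exact/funext.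
apply: cvgM; first exact: cvg_cst.
by apply: cvgB; [exact: cvg_cst|exact: cvg_harmonic].
Qed.

Variables (F : nat) (g : nat -> R) (B : R).
Hypothesis F0 : (0 < F)%N.
Hypothesis gB : forall k, `|g k| <= B.
Hypothesis gF : forall k, g (k + F)%N = - g k.

Local Notation phi x := (fun t : R => expR (- (x * ln t))).
Local Notation dsum w := (series (fun k => g k.+1 * w (k.+1%:R))).

(** By antiperiodicity the sum of g(k) w(k + F) is minus a tail of the sum of
g(k) w(k), so the two halves of the difference add up instead of cancelling. *)
Lemma dsum_diff_step (w : R -> R) (S : R) : dsum w @ \oo --> S ->
  dsum (diff_step F%:R w) @ \oo --> 2 * S - \sum_(k < F) g k.+1 * w k.+1%:R.
Proof.
move=> wS.
have -> : dsum (diff_step F%:R w) = (fun N => dsum w N + (dsum w (N + F)%N - dsum w F)).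
  apply/funext => N; rewrite sub_series_geq ?leq_addl//.
  have -> G : \sum_(F <= k < N + F) G k = \sum_(0 <= k < N) G (k + F)%N :> R.
    by rewrite -{1}[F]add0n big_addn addnK.
  rewrite /series/= -big_split/=; apply: eq_bigr => k _.
  by rewrite /diff_step -addSn gF natrD; ring.
have -> : 2 * S - \sum_(k < F) g k.+1 * w k.+1%:R = S + (S - dsum w F).
  by rewrite /series/= big_mkord; ring.
apply: cvgD => //; apply: cvgB; last exact: cvg_cst.
by rewrite cvg_shiftn.
Qed.

Definition initial_block i (w : R -> R) : R := \sum_(k < F) g k.+1 * iter_diff F%:R i w k.+1%:R.

Lemma dsum_iter_diff (w : R -> R) (S : R) J : dsum w @ \oo --> S ->
  dsum (iter_diff F%:R J w) @ \oo -->
    2 ^+ J * (S - \sum_(i < J) (2 ^+ i.+1)^-1 * initial_block i w).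
Proof.
move=> wS; elim: J => [|J IH]; first by rewrite big_ord0 subr0 mul1r.
have := dsum_diff_step IH; rewrite -/(initial_block J w).
set a := (X in X -> _); set b := (X in _ -> X).
suff -> : b = a by [].
rewrite /a /b; congr (_ @ _ --> _).
rewrite big_ord_recr/=; set s := (\sum_(i < J) _).
rewrite exprS; field.
by rewrite expf_neq0.
Qed.

Variable (M : nat).
Let J := M.+4.

(** With J = M + 4 the J-th differences of t^(-x) are O(t^(-2)) as soon as
x > - M - 1. *)
Definition difference_series x : R := limn (dsum (iter_diff F%:R J (phi x))).

Lemma initial_block_power_series i x0 : power_series_at (fun x => initial_block i (phi x)) x0.
Proof.
rewrite /initial_block; under eq_fun do rewrite -(big_mkord xpredT 
  (fun k => g k.+1 * iter_diff F%:R i (phi _) k.+1%:R)).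
apply: power_series_at_sum => k; apply: power_series_atZ.
exists 1 => //; exists (fun j => iter_diff F%:R i (pow_taylor x0 j) k.+1%:R) => x _.
exact: iter_diff_pow_taylor_series.
Qed.

(** Both the sum over the integers and the Taylor series converge absolutely, so
their order can be exchanged. *)
Lemma difference_series_power_series x0 : - M%:R - 1 < x0 -> power_series_at difference_series x0.
Proof.
move=> Mx0.
have FR : (0 : R) < F%:R by rewrite ltr0n.
have [C C0 HC] := iter_diff_pow_taylor_bound FR J x0.
pose m k := B * C * expR (- 2 * ln (k.+1%:R : R)).
have B0 : 0 <= B by apply: le_trans (gB 0%N).
have cm : cvgn (series m).
  have -> : m = (B * C) *: (fun k => expR (- 2 * ln (k.+1%:R : R))) by [].
  exact/is_cvg_seriesZ/is_cvg_inv_square.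
have bm j k : `|g k.+1 * iter_diff F%:R J (pow_taylor x0 j) k.+1%:R| <= m k.
  have k1 : (1 : R) <= k.+1%:R by rewrite ler1n.
  rewrite normrM /m -mulrA; apply: ler_pM => //.
  apply: le_trans (HC j _ k1) _; rewrite ler_wpM2l// ler_expR ler_wpM2r ?ln_ge0//.
  rewrite /J -[M.+4]addn4 natrD; lra.
exists 1 => //.
exists (fun j => limn (series (fun k => g k.+1 * iter_diff F%:R J (pow_taylor x0 j) k.+1%:R))) => x.
set y := x - x0 => y1.
pose a k j := g k.+1 * iter_diff F%:R J (pow_taylor x0 j) k.+1%:R * y ^+ j.
have := @double_series_swap _ a (fun k => g k.+1 * iter_diff F%:R J (phi x) k.+1%:R) m `|y|.
rewrite normr_ge0 y1 => /(_ isT cm).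
have -> : (fun j => limn (series (a^~ j))) =
  (fun k => limn (series (fun k0 => g k0.+1 * iter_diff F%:R J (pow_taylor x0 k) k0.+1%:R)) * y ^+ k).
  apply/funext => j; apply/cvg_lim => //.
  have -> : series (a^~ j) =
      (fun n => series (fun k => g k.+1 * iter_diff F%:R J (pow_taylor x0 j) k.+1%:R) n * y ^+ j).
    by apply/funext => n; rewrite /series/= mulr_suml.
  by apply: cvgM; [exact: series_majorized_cvg cm (bm j)|exact: cvg_cst].
apply.
  by move=> k j; rewrite /a normrM normrX ler_wpM2r ?exprn_ge0.
move=> k; have -> : series (a k) =
    (fun n => g k.+1 * series (fun j => iter_diff F%:R J (pow_taylor x0 j) k.+1%:R * y ^+ j) n).
  by apply/funext => n; rewrite /series/= mulr_sumr; apply: eq_bigr => j _; rewrite /a mulrA.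
by apply: cvgM; [exact: cvg_cst|exact: iter_diff_pow_taylor_series].
Qed.

Variable f : R -> R.
Hypothesis fps : forall x, power_series_at f x.
Hypothesis fser : forall x, 1 < x -> dsum (phi x) @ \oo --> f x.

(** The difference h between f and its candidate continuation vanishes for x > 1
by [dsum_iter_diff], hence for x > - M - 1; at x = - M the series of
differences is zero because t^M has degree less than J. *)
Theorem antiperiodic_value : f (- M%:R) =
  \sum_(i < M.+4) (2 ^+ i.+1)^-1 *
     \sum_(k < F) g k.+1 * ((iter i (Delta F) 'X^M).[k.+1%:Z])%:~R.
Proof.
pose h x := f x + (-1) * \sum_(i < J) (2 ^+ i.+1)^-1 * initial_block i (phi x)
   + (- (2 ^+ J)^-1) * difference_series x.
have h0 : h (- M%:R) = 0.
  apply: (@identity_theorem _ h (- M%:R - 1) 1); last by lra.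
    move=> x Mx; apply: power_series_atD; last exact/power_series_atZ/difference_series_power_series.
    apply: power_series_atD => //; apply: power_series_atZ.
    under eq_fun do rewrite -(big_mkord xpredT (fun i => (2 ^+ i.+1)^-1 * initial_block i (phi _))).
    by apply: power_series_at_sum => i; apply: power_series_atZ; exact: initial_block_power_series.
  move=> x x1; rewrite /h /difference_series (cvg_lim _ (dsum_iter_diff (J := J) (fser x1)))//.
  set s := (\sum_(_ < _) _); field; by rewrite expf_neq0.
have phiM s : (0 < s)%N -> (phi (- M%:R)) s%:R = ('X^M : {poly int}).[s%:Z]%:~R.
  by move=> s0; rewrite mulNr opprK expRM_natl lnK ?posrE ?ltr0n// hornerXn rmorphXn.
have dh i s (s0 : (0 < s)%N) := @iter_diff_horner (phi (- M%:R)) 'X^M F i phiM s s0.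
have r0 : difference_series (- M%:R) = 0.
  rewrite /difference_series (_ : series _ = fun=> 0).
    by apply/cvg_lim => //; exact: cvg_cst.
  apply/funext => n; rewrite seriesEnat; apply: big1 => k _.
  by rewrite dh// iter_Delta_eq0 ?horner0 ?mulr0// size_polyXn /J; lia.
move: h0; rewrite /h r0 mulr0 addr0 mulN1r => /eqP; rewrite subr_eq0 => /eqP ->.
apply: eq_bigr => i _; congr (_ * _); apply: eq_bigr => k _.
by rewrite dh.
Qed.
End Value.

(** * Passage to complex coefficients *)

Section ComplexValue.
Local Open Scope classical_set_scope.
Variable R : realType.

(** The map rho stands for the real or the imaginary part; both reduce a
Dirichlet series with complex coefficients to real ones. *)
Section RealProjection.
Variable rho : R[i] -> R.
Hypothesis rhoD : {morph rho : z w / z + w}.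
Hypothesis rhoR : forall z (x : R), rho (z * x%:C) = rho z * x.
Hypothesis rho_norm : forall z, (`|rho z|)%:C <= `|z|.

Let rho0 : rho 0 = 0.
Proof. by have := rhoR 0 0; rewrite mul0r mulr0. Qed.

Let rhoB z w : rho (z - w) = rho z - rho w.
Proof. by apply/eqP; rewrite eq_sym subr_eq -rhoD subrK. Qed.

Lemma rho_sum I (r : seq I) (G : I -> R[i]) :
  rho (\sum_(i <- r) G i) = \sum_(i <- r) rho (G i).
Proof. exact: big_morph. Qed.

Lemma rho_cvg (u : nat -> R[i]) (l : R[i]) :
  (u : nat -> R[i]^o) @ \oo --> (l : R[i]^o) -> (fun n => rho (u n)) @ \oo --> rho l.
Proof.
move=> /cvgrPdist_lt H; apply/cvgrPdist_lt => e e0.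
have ec : (0 : R[i]) < e%:C by rewrite ltcR.
near=> n; rewrite -rhoB -ltcR.
apply: le_lt_trans (rho_norm _) _.
by near: n; exact: H.
Unshelve. all: by end_near. Qed.

Lemma rho_series (u : nat -> R[i]) (l : R[i]) :
  series (u : nat -> R[i]^o) @ \oo --> (l : R[i]^o) ->
  series (fun k => rho (u k)) @ \oo --> rho l.
Proof.
move/rho_cvg => h; suff <- : (fun n => rho (series (u : nat -> R[i]^o) n)) = series (fun k => rho (u k)) by [].
by apply/funext => n; rewrite /series/= rho_sum.
Qed.

Variables (rh : int -> R[i]) (L : R[i] -> R[i]).
Hypothesis hL : dirichlet_L_function rh L.

Lemma rho_L_power_series x0 : power_series_at (fun x => rho (L x%:C)) x0.
Proof.
have [r r0 [a Ha]] := hL.1 x0%:C.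
exists r => //; exists (fun k => rho (a k)) => x xr.
have := Ha x%:C; rewrite -rmorphB /= normc_def /= expr0n addr0 sqrtr_sqr ltcR => /(_ xr)/rho_series.
suff -> : (fun k => rho (a k * (x - x0)%:C ^+ k)) = (fun k => rho (a k) * (x - x0) ^+ k) by [].
by apply/funext => k; rewrite -rmorphXn rhoR.
Qed.

Lemma rho_L_series (x : R) : 1 < x ->
  series (fun k => rho (rh k.+1%:Z) * expR (- (x * ln k.+1%:R))) @ \oo --> rho (L x%:C).
Proof.
move=> x1; have /rho_series := hL.2 x%:C x1.
suff -> : (fun k => rho (rh k.+1%:Z * natpowC k.+1 (- x%:C))) =
  (fun k => rho (rh k.+1%:Z) * expR (- (x * ln k.+1%:R))) by [].
apply/funext => k.
rewrite -rhoR; congr (rho (_ * _)).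
rewrite /natpowC -rmorphN -rmorphM /cexp /= cos0 sin0 mulr1 mulr0.
by rewrite mulNr.
Qed.

Variables (F : nat).
Hypothesis F0 : (0 < F)%N.
Hypothesis rhF : forall k : int, rh (k + F%:Z) = - rh k.

Lemma rho_L_value M : rho (L (- M%:R)%:C) =
  \sum_(i < M.+4) (2 ^+ i.+1)^-1 *
     \sum_(k < F) rho (rh k.+1%:Z) * ((iter i (Delta F) 'X^M).[k.+1%:Z])%:~R.
Proof.
have rhoN z : rho (- z) = - rho z by rewrite -sub0r rhoB rho0 sub0r.
pose B := \sum_(k < F) `|rho (rh k%:Z)|.
apply: (@antiperiodic_value _ F (fun k => rho (rh k%:Z)) B F0 _ _ M
         (fun x => rho (L x%:C)) rho_L_power_series rho_L_series).
  elim/ltn_ind => k IH.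
  have [kF|Fk] := ltnP k F.
    by rewrite /B (bigD1 (Ordinal kF))//= lerDl sumr_ge0.
  have -> : rho (rh k) = - rho (rh (k - F)%N%:Z).
    by rewrite -{1}(subnK Fk) PoszD rhF rhoN.
  by rewrite normrN; apply: IH; rewrite ltn_subrL F0 (leq_trans F0 Fk).
by move=> k; rewrite PoszD rhF rhoN.
Qed.
End RealProjection.

(** The real and imaginary parts of L on the real axis are real-analytic sums of
antiperiodic Dirichlet series. *)
Theorem L_value_antiperiodic (rh : int -> R[i]) (L : R[i] -> R[i]) (F M : nat) :
  dirichlet_L_function rh L -> (0 < F)%N ->
  (forall k : int, rh (k + F%:Z) = - rh k) ->
  L (- M%:R) = \sum_(i < M.+4) (2 ^+ i.+1)^-1 *
     \sum_(k < F) rh k.+1%:Z * ((iter i (Delta F) 'X^M).[k.+1%:Z])%:~R.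
Proof.
move=> hL F0 rhF; set S := RHS.
have rhoS (rho : R[i] -> R) : {morph rho : z w / z + w} ->
    (forall z (x : R), rho (z * x%:C) = rho z * x) ->
    (forall z, (`|rho z|)%:C <= `|z|) -> rho (L (- M%:R)) = rho S.
  move=> rhoD rhoR rhon.
  have -> : (- M%:R : R[i]) = (- M%:R)%:C by rewrite rmorphN rmorph_nat.
  rewrite (rho_L_value rhoD rhoR rhon hL F0 rhF) /S.
  have rho0 : rho 0 = 0 by have := rhoR 0 0; rewrite mul0r mulr0.
  rewrite (big_morph rho rhoD rho0); apply: eq_bigr => i _.
  have -> : ((2 : R[i]) ^+ i.+1)^-1 = ((2 ^+ i.+1)^-1)%:C.
    by rewrite fmorphV rmorphXn rmorph_nat.
  rewrite [in RHS]mulrC rhoR mulrC; congr (_ * _).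
  rewrite (big_morph rho rhoD rho0); apply: eq_bigr => k _.
  by rewrite -rhoR rmorph_int.
have Re_eq : complex.Re (L (- M%:R)) = complex.Re S.
  apply: rhoS.
  - by case=> a b [c d].
  - by case=> a b x /=; rewrite mulr0 subr0.
  - by move=> z; apply: le_trans (normc_ge_Re z); rewrite lecR.
have Im_eq : complex.Im (L (- M%:R)) = complex.Im S.
  apply: rhoS.
  - by case=> a b [c d].
  - by case=> a b x /=; rewrite mulr0 add0r.
  - move=> [a b]; rewrite normc_def lecR /=.
    rewrite -(sqrtr_sqr b) ler_wsqrtr// lerDr sqr_ge0//.
by rewrite [LHS]complexE [RHS]complexE Re_eq Im_eq.
Qed.
End ComplexValue.

(** * Two-adic valuations of algebraic numbers *)

Lemma PoszX (m k : nat) : (m ^ k)%N%:Z = m%:Z ^+ k.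
Proof. by elim: k => [|k IH] //; rewrite expnS PoszM exprS IH. Qed.

Section Valuation.
Variables (R : realType) (v : algC -> \bar R).
Hypothesis hv : two_adic_valuation v.
Implicit Types (x y : algC) (a b : R).

(** Divisibility in the sense of v: the congruences below are all of this form. *)
Definition vge a x := (a%:E <= v x)%E.

Let v_inf x : v x = +oo%E <-> x = 0. Proof. by case: hv. Qed.
Let vM x y : v (x * y) = (v x + v y)%E. Proof. by case: hv. Qed.
Let v_min x y : (Order.min (v x) (v y) <= v (x + y)%R)%E. Proof. by case: hv. Qed.

Lemma v_fin x : x != 0 -> exists a, v x = a%:E.
Proof.
move=> x0; case E: (v x) => [a| |]; first by exists a.
- by move/v_inf: E x0 => ->; rewrite eqxx.
- by case: hv => _ /(_ x) /(_ E).
Qed.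

Lemma v_neq0 x a : v x = a%:E -> x != 0.
Proof. by move=> E; apply/eqP => /v_inf; rewrite E. Qed.

Lemma vge0 a : vge a 0.
Proof. by rewrite /vge (v_inf 0).2 ?leey. Qed.

Lemma vgeD a x y : vge a x -> vge a y -> vge a (x + y).
Proof. by move=> xa ya; apply: le_trans (v_min x y); rewrite le_min; apply/andP. Qed.

Lemma vge_sum I (r : seq I) (P : pred I) (G : I -> algC) a :
  (forall i, P i -> vge a (G i)) -> vge a (\sum_(i <- r | P i) G i).
Proof. by move=> H; apply: (big_ind (vge a)) => //; [exact: vge0|move=> x y; exact: vgeD]. Qed.

Lemma vgeM a b x y : vge a x -> vge b y -> vge (a + b) (x * y).
Proof. by rewrite /vge vM EFinD; exact: leeD. Qed.

Lemma vge_le a b x : b <= a -> vge a x -> vge b x.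
Proof. by move=> ba; apply: le_trans; rewrite lee_fin. Qed.

Lemma veq_ge a x : v x = a%:E -> vge a x.
Proof. by rewrite /vge => ->. Qed.

Lemma veqM x y a b : v x = a%:E -> v y = b%:E -> v (x * y) = (a + b)%:E.
Proof. by rewrite vM => -> ->. Qed.

Lemma v1 : v 1 = 0%:E.
Proof.
have [a Ea] := v_fin (oner_neq0 algC).
have := veqM Ea Ea; rewrite mulr1 Ea => -[] /eqP.
by rewrite addrC -subr_eq subrr eq_sym => /eqP->.
Qed.

Lemma veqX x a k : v x = a%:E -> v (x ^+ k) = (k%:R * a)%:E.
Proof.
move=> xa; elim: k => [|k IH]; first by rewrite mul0r v1.
by rewrite exprS (veqM xa IH) -natr1; congr EFin; ring.
Qed.

Lemma v_unity_root x k : (0 < k)%N -> x ^+ k = 1 -> v x = 0%:E.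
Proof.
move=> k0 xk.
have x0 : x != 0.
  by apply/eqP => x0; move: xk; rewrite x0 expr0n gtn_eqF//= => /eqP; rewrite eq_sym oner_eq0.
have [a Ea] := v_fin x0.
have := veqX k Ea; rewrite xk v1 => -[] /esym/eqP.
by rewrite mulf_eq0 pnatr_eq0 gtn_eqF//= => /eqP a0; rewrite Ea a0.
Qed.

Lemma vN x : v (- x) = v x.
Proof.
rewrite -mulN1r vM (@v_unity_root (-1) 2) ?add0e//.
by rewrite expr2 mulrNN mulr1.
Qed.

Lemma vgeN a x : vge a (- x) = vge a x.
Proof. by rewrite /vge vN. Qed.

Lemma vgeB a x y : vge a x -> vge a y -> vge a (x - y).
Proof. by move=> xa ya; apply: vgeD => //; rewrite vgeN. Qed.

Lemma vge_nat k : vge 0 k%:R.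
Proof.
elim: k => [|k IH]; first exact: vge0.
by rewrite -natr1; apply: vgeD => //; rewrite /vge v1.
Qed.

Lemma vge_int (z : int) : vge 0 z%:~R.
Proof. by case: z => k; rewrite ?NegzE ?rmorphN /= ?vgeN; exact: vge_nat. Qed.

Lemma veqD x y a b : v x = a%:E -> vge b y -> a < b -> v (x + y) = a%:E.
Proof.
move=> xa yb ab; apply/le_anti/andP; split; last first.
  apply: le_trans (v_min x y); rewrite le_min xa lexx/=.
  exact: vge_le (ltW ab) yb.
have := v_min (x + y) (- y); rewrite addrK xa vN ge_min => /orP[//|].
by rewrite leNgt => /negP[]; apply: lt_le_trans yb; rewrite lte_fin.
Qed.

Lemma v2 : v 2 = 1%:E. Proof. by case: hv. Qed.

Lemma vge_dvd2X (z : int) k : (2 ^+ k %| z)%Z -> vge k%:R z%:~R.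
Proof.
move=> /dvdzP[w ->]; rewrite rmorphM -[k%:R]add0r; apply: vgeM; first exact: vge_int.
by rewrite rmorphXn /=; apply: veq_ge; rewrite (veqX k v2) mulr1.
Qed.

Lemma vge_even (z : int) : (2 %| z)%Z -> vge 1 z%:~R.
Proof. exact: (@vge_dvd2X z 1). Qed.

Lemma v_odd (z : int) : ~~ (2 %| z)%Z -> v z%:~R = 0%:E.
Proof.
move=> oz; have [w ->] : exists w, z = 1 + w * 2.
  exists (z %/ 2)%Z; have := divz_eq z 2; have : (z %% 2)%Z = 1.
    have := modz_ge0 z (d := 2) isT; have := ltz_pmod z (d := 2) isT.
    by move: oz; rewrite dvdzE /=; lia.
  by lia.
rewrite rmorphD rmorph1; apply: veqD v1 _ ltr01.
by apply: vge_even; apply/dvdzP; exists w.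
Qed.

Lemma v_inv x a : v x = a%:E -> v x^-1 = (- a)%:E.
Proof.
move=> xa; have x0 := v_neq0 xa.
have [b Eb] := v_fin (invr_neq0 x0).
have := veqM xa Eb; rewrite mulfV// v1 => -[] ab.
by rewrite Eb; congr EFin; lra.
Qed.

(** Since 1 + z = 2 - (1 - z), the factors of 1 - z^2 = (1 - z) (1 + z) have the
same valuation, which is therefore halved each time k increases. *)
Lemma v_one_minus_root k z : z ^+ (2 ^ k) = -1 -> v (1 - z) = (2 ^+ k)^-1%:E.
Proof.
elim: k z => [|k IH] z.
  by rewrite expn0 expr1 => ->; rewrite opprK invr1; exact: v2.
rewrite expnS exprM => /IH vz.
have e : (1 - z) * (1 + z) = 1 - z ^+ 2 by ring.
have kle : (2 ^+ k)^-1 <= 1 :> R.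
  by rewrite invf_le1 ?exprn_gt0// exprn_ege1// ler1n.
have n1 := v_neq0 vz; rewrite -e mulf_eq0 negb_or in n1; case/andP: n1 => nx ny.
have [a Ea] := v_fin nx; have [b Eb] := v_fin ny.
have := veqM Ea Eb; rewrite e vz => -[] abk.
have yE : 1 + z = - (1 - z) + 2 by ring.
have [a1|a1] := ltP a 1.
  have : v (1 + z) = a%:E.
    by rewrite yE; apply: veqD (veq_ge v2) a1; rewrite vN.
  rewrite Eb => -[] ba; rewrite Ea exprS; congr EFin.
  by rewrite invfM abk ba; field.
have : vge 1 (1 + z).
  rewrite yE; apply: vgeD; last exact: veq_ge v2.
  by rewrite vgeN; apply: vge_le a1 _; exact: veq_ge.
rewrite /vge Eb lee_fin => b1; suff : 1 < (2 ^+ k)^-1 :> R by rewrite ltNge kle.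
by rewrite abk; lra.
Qed.

(** If z - 1 had a smaller valuation then z + 1 = (z - 1) + 2 would share it, and
z^2 - 1 would have too small a valuation. *)
Lemma vge_unity_root_sub1 k z : z ^+ (2 ^ k) = 1 -> vge (2 ^+ k)^-1 (z - 1).
Proof.
elim: k z => [|k IH] z; first by rewrite expr1 => ->; rewrite subrr; exact: vge0.
rewrite expnS exprM => /IH vz.
have [->|z1] := eqVneq (z - 1) 0; first exact: vge0.
have e : z ^+ 2 - 1 = (z - 1) * (z + 1) by ring.
have kle : (2 ^+ k.+1)^-1 <= 1 :> R.
  by rewrite invf_le1 ?exprn_gt0// exprn_ege1// ler1n.
have [a Ea] := v_fin z1.
rewrite /vge Ea lee_fin leNgt; apply/negP => ak.
have Eb : v (z + 1) = a%:E.
  have -> : z + 1 = (z - 1) + 2 by ring.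
  by apply: veqD Ea (veq_ge v2) _; lra.
move: vz; rewrite e /vge (veqM Ea Eb) lee_fin.
have : (2 ^+ k)^-1 = 2 * (2 ^+ k.+1)^-1 :> R.
  by rewrite exprS invfM mulrA mulfV ?mul1r.
move=> e2 h; suff : (2 ^+ k.+1)^-1 <= a by rewrite leNgt ak.
by lra.
Qed.
End Valuation.

(** * The regularized sum modulo powers of two *)

Lemma Delta_lin F (c : int) (P Q : {poly int}) :
  Delta F (c *: P + Q) = c *: Delta F P + Delta F Q.
Proof. by rewrite /Delta comp_polyD comp_polyZ scalerBr; ring. Qed.

Lemma iter_Delta_lin F i (c : int) (P Q : {poly int}) :
  iter i (Delta F) (c *: P + Q) = c *: iter i (Delta F) P + iter i (Delta F) Q.
Proof. by elim: i => [|i IH] //=; rewrite IH Delta_lin. Qed.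

Lemma Delta_dvd F (P : {poly int}) : exists Q, Delta F P = F%:Z *: Q.
Proof.
elim/poly_ind: P => [|P c [Q HQ]].
  by exists 0; rewrite /Delta comp_poly0 subr0 scaler0.
exists (Q * ('X + F%:Z%:P) - P).
have -> : Delta F (P * 'X + c%:P) = Delta F P * ('X + F%:Z%:P) - F%:Z *: P.
  by rewrite /Delta comp_polyD comp_polyM comp_polyX comp_polyC -mul_polyC; ring.
by rewrite HQ -!mul_polyC; ring.
Qed.

(** The step of Delta is even, so each application contributes a factor 2; this
compensates the denominators 2^(i+1) of [regularized_sum]. *)
Lemma iter_Delta_dvd H i (P : {poly int}) :
  exists Q, iter i (Delta H.*2) P = (2 ^+ i : int) *: Q.
Proof.
elim: i => [|i [Q HQ]] /=; first by exists P; rewrite expr0 scale1r.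
have [Q' HQ'] := Delta_dvd H.*2 Q.
exists (H%:Z *: Q').
have := Delta_lin H.*2 (2 ^+ i) Q 0; rewrite addr0 -HQ => ->.
have -> : Delta H.*2 0 = 0 by rewrite /Delta comp_poly0 subr0.
rewrite addr0 HQ' !scalerA; congr (_ *: _).
by rewrite -mul2n PoszM exprS; ring.
Qed.

(** Odd powers of c cancel, so the sum differs from twice X^M by a multiple of
2 c^2.  The induction needs the companion statement for the difference of the
two powers. *)
Lemma centered_binomial (c : int) M : exists Q : {poly int},
  ('X + c%:P) ^+ M + ('X - c%:P) ^+ M = (2 : int) *: 'X^M + (2 * c ^+ 2) *: Q.
Proof.
suff [Q [S [-> _]]] : exists Q S : {poly int},
    ('X + c%:P) ^+ M + ('X - c%:P) ^+ M = (2 : int) *: 'X^M + (2 * c ^+ 2) *: Q /\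
    ('X + c%:P) ^+ M - ('X - c%:P) ^+ M = (2 * c) *: S by exists Q.
elim: M => [|M [Q [S [HA HB]]]].
  exists 0, 0; rewrite !expr0 !scaler0 subrr addr0; split => //.
  by rewrite -mul_polyC mulr1 rmorphD rmorph1.
exists ('X * Q + S), ('X * S + 'X^M + c ^+ 2 *: Q); split.
  have -> : ('X + c%:P) ^+ M.+1 + ('X - c%:P) ^+ M.+1 =
     'X * (('X + c%:P) ^+ M + ('X - c%:P) ^+ M) + c%:P * (('X + c%:P) ^+ M - ('X - c%:P) ^+ M).
    by rewrite !exprS; ring.
  by rewrite HA HB -!mul_polyC !rmorphM ?rmorphXn /= exprS; ring.
have -> : ('X + c%:P) ^+ M.+1 - ('X - c%:P) ^+ M.+1 =
     'X * (('X + c%:P) ^+ M - ('X - c%:P) ^+ M) + c%:P * (('X + c%:P) ^+ M + ('X - c%:P) ^+ M).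
  by rewrite !exprS; ring.
by rewrite HA HB -!mul_polyC !rmorphM ?rmorphXn /=; ring.
Qed.

Section Ell.
Variables (R : realType) (v : algC -> \bar R).
Hypothesis hv : two_adic_valuation v.
Variables (g : int -> algC) (H : nat).
Hypothesis gF : forall k : int, g (k + H.*2%:Z) = - g k.

(** The regularized value of the divergent sum of g(k) P(k) over k > 0.  If E is
the translation by 2H, antiperiodicity suggests that 1 + E = 2 - Delta maps P
to a summand whose sum is finite, and the series of Delta^i / 2^(i+1) inverts
2 - Delta on polynomials. *)
Definition regularized_sum J (P : {poly int}) : algC :=
  \sum_(i < J) (2 ^+ i.+1)^-1 *
    \sum_(k < H.*2) g k.+1%:Z * ((iter i (Delta H.*2) P).[k.+1%:Z])%:~R.

Lemma regularized_sum_lin J (c : int) P Q :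
  regularized_sum J (c *: P + Q) = c%:~R * regularized_sum J P + regularized_sum J Q.
Proof.
rewrite /regularized_sum mulr_sumr -big_split/=; apply: eq_bigr => i _.
rewrite !mulr_sumr -big_split/=; apply: eq_bigr => k _.
by rewrite iter_Delta_lin hornerD hornerZ rmorphD rmorphM /=; ring.
Qed.

(** The sum telescopes, and its last term vanishes with Delta^J P. *)
Lemma regularized_sum_shift J (P : {poly int}) : (size P <= J)%N ->
  regularized_sum J (P + (P \Po ('X + (H.*2)%:Z%:P))) =
  \sum_(k < H.*2) g k.+1%:Z * (P.[k.+1%:Z])%:~R.
Proof.
move=> sP.
pose T i := \sum_(k < H.*2) g k.+1%:Z * ((iter i (Delta H.*2) P).[k.+1%:Z])%:~R.
have TJ : T J = 0.
  by rewrite /T iter_Delta_eq0// big1// => k _; rewrite horner0 mulr0.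
have -> : P + (P \Po ('X + (H.*2)%:Z%:P)) = (2 : int) *: P + (- 1 : int) *: Delta H.*2 P.
  by rewrite /Delta scaleN1r -mul_polyC rmorphD rmorph1; ring.
transitivity (T 0%N - (2 ^+ J)^-1 * T J); last by rewrite TJ mulr0 subr0.
rewrite /regularized_sum; elim: J {sP TJ} => [|J IH]; first by rewrite big_ord0 invr1 mul1r subrr.
rewrite big_ord_recr /= IH.
have -> : \sum_(k < H.*2) g k.+1%:Z * ((iter J (Delta H.*2) ((2 : int) *: P + (- 1 : int) *: Delta H.*2 P)).[k.+1%:Z])%:~R
   = 2 * T J - T J.+1.
  rewrite /T mulr_sumr -sumrB; apply: eq_bigr => k _.
  have := iter_Delta_lin H.*2 J (- 1) (Delta H.*2 P) 0; rewrite addr0 => e.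
  rewrite iter_Delta_lin e.
  have -> : iter J (Delta H.*2) 0 = 0 by rewrite iter_Delta_eq0// size_poly0.
  rewrite -iterSr addr0 hornerD !hornerZ rmorphD !rmorphM /=; ring.
have t0 : (2 : algC) ^+ J != 0 by rewrite expf_neq0.
by rewrite exprS; field.
Qed.

Hypothesis gv : forall k, vge v 0 (g k).

Lemma regularized_sum_vge J P : vge v (- 1) (regularized_sum J P).
Proof.
apply: (vge_sum hv) => i _.
have [Q HQ] := iter_Delta_dvd H i P.
have -> : -1 = - (i.+1%:R * 1) + i%:R :> R by rewrite -natr1; ring.
apply: (vgeM hv); first by apply: veq_ge; apply: (v_inv hv); apply: (veqX hv); exact: v2.
apply: (vge_sum hv) => k _; rewrite -[i%:R]add0r; apply: (vgeM hv) => //.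
by apply: (vge_dvd2X hv); rewrite HQ hornerZ; apply: dvdz_mulr.
Qed.

Hypothesis gN : forall k : int, g (- k) = g k.
Hypothesis g0 : g 0 = 0.
Variable (M n : nat).
Hypothesis oM : odd M.

(** Around the centre H the function g and the odd power of k - H are both odd,
so the terms at k and 2H - k agree. *)
Lemma centered_sum :
  \sum_(k < H.*2) g k.+1%:Z * ((k.+1%:Z - H%:Z) ^+ M)%:~R =
  2 * \sum_(k < H) g k%:Z * ((k%:Z - H%:Z) ^+ M)%:~R.
Proof.
pose G (k : int) := g k * ((k - H%:Z) ^+ M)%:~R.
have M0 : (0 < M)%N by case: M oM.
have GH : G H%:Z = 0 by rewrite /G subrr expr0n gtn_eqF// mulr0.
have G0 : G 0 = 0 by rewrite /G g0 mul0r.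
have Gr k : G (- k + H.*2%:Z) = G k.
  rewrite /G gF gN.
  have -> : - k + H.*2%:Z - H%:Z = - (k - H%:Z) by rewrite -addnn PoszD; ring.
  by rewrite exprNn -signr_odd oM expr1 mulN1r rmorphN mulrNN.
rewrite -(big_mkord xpredT (fun k => G k.+1%:Z)) -(big_mkord xpredT (fun k => G k%:Z)).
rewrite (@big_cat_nat _ _ _ H)//=; last by rewrite -addnn leq_addr.
have e1 : \sum_(0 <= k < H) G k.+1%:Z = \sum_(0 <= k < H) G k%:Z.
  have : \sum_(0 <= k < H.+1) G k%:Z = G 0 + \sum_(0 <= k < H) G k.+1%:Z by rewrite big_nat_recl.
  by rewrite big_nat_recr//= GH G0 add0r addr0 => ->.
have e2 : \sum_(H <= k < H.*2) G k.+1%:Z = \sum_(0 <= k < H) G k%:Z.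
  rewrite -{1}[H]add0n -addnn big_addn addnK [RHS]big_nat_rev/= add0n.
  apply: eq_big_nat => k /andP[_ kH]; rewrite -Gr; congr G.
  by rewrite -addnn PoszD; lia.
by rewrite e1 e2; ring.
Qed.

(** Use (X - H)^M in the functional equation: its translate by 2H is (X + H)^M,
and the two add up to 2 X^M modulo 2 H^2.  The centred form matters: with X^M
alone the first error term would only be divisible by H / 2. *)
Lemma regularized_sum_congruence J : (M < J)%N -> (0 < n)%N -> (2 ^ n %| H)%N ->
  vge v n%:R (regularized_sum J 'X^M - \sum_(k < H) g k%:Z * (k%:Z ^+ M)%:~R).
Proof.
move=> MJ n0 dH.
have dHz : ((2 : int) ^+ n %| H%:Z)%Z.
  by rewrite dvdzE abszX.
have vH : vge v n%:R (H%:Z%:~R : algC) by exact: (vge_dvd2X hv).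
have [Q HQ] := centered_binomial H%:Z M.
pose P := ('X - (H%:Z)%:P) ^+ M : {poly int}.
have sP : (size P <= J)%N by rewrite /P size_exp_XsubC.
have PE : P + (P \Po ('X + (H.*2)%:Z%:P)) = (2 * H%:Z ^+ 2) *: Q + ((2 : int) *: 'X^M + 0).
  rewrite addr0 [RHS]addrC -HQ addrC /P; congr (_ + _).
  rewrite rmorphXn /= comp_polyB comp_polyX comp_polyC -addrA -rmorphB /=.
  by congr (('X + _%:P) ^+ M); rewrite -addnn PoszD addrK.
have := regularized_sum_shift sP; rewrite PE !regularized_sum_lin.
have -> : regularized_sum J 0 = 0.
  rewrite /regularized_sum big1// => i _; rewrite big1 ?mulr0// => k _.
  by rewrite iter_Delta_eq0 ?size_poly0// horner0 mulr0.
have -> : \sum_(k < H.*2) g k.+1%:Z * (P.[k.+1%:Z])%:~R =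
   \sum_(k < H.*2) g k.+1%:Z * ((k.+1%:Z - H%:Z) ^+ M)%:~R.
  by apply: eq_bigr => k _; rewrite /P horner_exp !hornerE.
rewrite centered_sum addr0 rmorphM /= => e.
set S := \sum_(k < H) _ in e *.
have -> : regularized_sum J 'X^M = S - (H%:Z ^+ 2)%:~R * regularized_sum J Q.
  have t0 : (2 : algC) != 0 by [].
  by apply: (mulfI t0); rewrite mulrBr -e; ring.
rewrite addrAC; apply: (vgeB hv).
  rewrite /S -sumrB; apply: (vge_sum hv) => k _.
  rewrite -mulrBr -rmorphB /= -[n%:R]add0r; apply: (vgeM hv) => //.
  apply: (vge_dvd2X hv); apply: dvdz_trans dHz _.
  by rewrite subrXX; apply: dvdz_mulr; rewrite addrAC subrr add0r dvdzE abszN dvdnn.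
rewrite rmorphXn /= expr2 -mulrA -[n%:R]addr0; apply: (vgeM hv) => //.
apply: (@vge_le _ _ (n%:R + -1)); first by rewrite subr_ge0 ler1n.
exact: (vgeM hv) (regularized_sum_vge _ _).
Qed.
End Ell.

(** * Power sums over half a period *)

(** The permutation behind the lemma of Gauss: reduce c k to its representative
of least absolute value modulo 2H and forget the sign. *)
Lemma gauss_perm (H c : nat) : (0 < H)%N -> coprime H.*2 c ->
  exists2 pi : 'I_H -> 'I_H, injective pi &
    forall k : 'I_H, exists t : nat, (c * k = pi k + t * H.*2 \/ c * k + pi k = t * H.*2)%N.
Proof.
move=> H0 cop.
pose r (k : 'I_H) := ((c * k) %% H.*2)%N.
have r_neqH k : r k != H.
  apply/eqP => rk.
  have dck : (H %| c * k)%N.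
    rewrite (divn_eq (c * k) H.*2) -/(r k) rk; apply: dvdn_add => //.
    by rewrite -muln2 mulnCA dvdn_mulr.
  have cH : coprime H c by move: cop; rewrite -muln2 coprimeMl => /andP[].
  move: dck; rewrite Gauss_dvdr// => dk.
  have k0 : (k = 0 :> nat)%N.
    by apply/eqP; rewrite -leqn0 leqNgt; apply/negP => kp; have := dvdn_leq kp dk; rewrite leqNgt ltn_ord.
  by move: rk H0; rewrite /r k0 muln0 mod0n => <-.
have rlt k : (r k < H.*2)%N by rewrite ltn_mod double_gt0.
have plt k : ((if r k < H then r k else H.*2 - r k) < H)%N.
  have := r_neqH k; have := rlt k; move: (r k) => x xl xH; by case: (ltnP x H) => // Hx; lia.
exists (fun k => Ordinal (plt k)).
  move=> k k' /(congr1 val) /=.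
  have kH := ltn_ord k; have k'H := ltn_ord k'.
  have rr (a : 'I_H) : exists t : nat, (c * a = r a + t * H.*2)%N.
    by exists ((c * a) %/ H.*2)%N; rewrite addnC -divn_eq.
  have [t Ht] := rr k; have [t' Ht'] := rr k'.
  have dz (z : int) : (H.*2%:Z %| c%:Z * z)%Z -> (H.*2%:Z %| z)%Z.
    by rewrite Gauss_dvdzr.
  have small (z : int) : (H.*2%:Z %| z)%Z -> (`|z| < H.*2)%N -> z = 0.
    rewrite dvdzE /= => d1 d2; apply/eqP; rewrite -absz_eq0 -leqn0 leqNgt; apply/negP => d3.
    by have := dvdn_leq d3 d1; rewrite leqNgt d2.
  have minus : r k = r k' -> k = k'.
    move=> e; apply/val_inj/eqP => /=; rewrite -eqz_nat -subr_eq0; apply/eqP.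
    apply: small; last by lia.
    apply: dz; apply/dvdzP; exists (t%:Z - t'%:Z).
    by rewrite mulrBr mulrBl -!PoszM Ht Ht' e !PoszD; lia.
  have plus : (r k + r k' = H.*2)%N -> k = k'.
    move=> e; have : k%:Z + k'%:Z = 0.
      apply: small; last by lia.
      apply: dz; apply/dvdzP; exists (t%:Z + t'%:Z + 1).
      have e' : (r k)%:Z + (r k')%:Z = H.*2%:Z by rewrite -e PoszD.
      rewrite mulrDr -(PoszM c k) -(PoszM c k') Ht Ht' !PoszD !PoszM.
      by move: (r k)%:Z (r k')%:Z (H.*2%:Z) e' => x y h <-; ring.
    by move=> e0; apply/val_inj => /=; lia.
  have := rlt k; have := rlt k'.
  case: (ltnP (r k) H) => h1; case: (ltnP (r k') H) => h2 l1 l2 e.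
  - exact: minus.
  - by apply: plus; lia.
  - by apply: plus; lia.
  - by apply: minus; lia.
move=> k /=; have e := divn_eq (c * k) H.*2.
case: ltnP => h.
  by exists ((c * k) %/ H.*2)%N; left; rewrite {1}e addnC.
exists ((c * k) %/ H.*2).+1; right; have := rlt k.
by rewrite {1}e -/(r k) mulSn; lia.
Qed.

Section Sums.
Variables (R : realType) (v : algC -> \bar R).
Hypothesis hv : two_adic_valuation v.
Variables (M n : nat).
Hypothesis oM : odd M.

Definition half_sum (g : int -> algC) (H : nat) : algC :=
  \sum_(k < H) g k%:Z * (k%:Z ^+ M)%:~R.

Definition even_antiperiodic (g : int -> algC) (H : nat) :=
  [/\ forall k, vge v 0 (g k), forall k : int, g (- k) = g k
    & forall k : int, g (k + H.*2%:Z) = - g k].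

Lemma antiperiodic_mul g H (t : nat) k : even_antiperiodic g H ->
  g (k + (t * H.*2)%:Z) = (-1) ^+ t * g k.
Proof.
move=> [_ _ gF]; elim: t => [|t IH]; first by rewrite mul0n addr0 mul1r.
by rewrite mulSn addnC PoszD addrA gF IH exprS; ring.
Qed.

(** The reflection maps [a, b) to (a, b], hence the vanishing conditions. *)
Lemma sum_nat_reflect (G : nat -> algC) a b : (a <= b)%N -> G a = 0 -> G b = 0 ->
  \sum_(a <= k < b) G k = \sum_(a <= k < b) G (a + b - k)%N.
Proof.
move=> ab Ga Gb.
have : \sum_(a <= k < b.+1) G k = G a + \sum_(a <= k < b) G k.+1 by rewrite big_nat_recl.
rewrite big_nat_recr//= Ga Gb addr0 add0r => ->.
rewrite big_nat_rev/=; apply: eq_big_nat => k /andP[ak kb]; congr G; lia.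
Qed.

Lemma even_antiperiodic_half g H : even_antiperiodic g H -> g H%:Z = 0.
Proof.
move=> [_ gN gF]; have := gF (- H%:Z).
have -> : - H%:Z + H.*2%:Z = H%:Z by rewrite -addnn PoszD; ring.
rewrite gN => /eqP; rewrite -addr_eq0 -mulr2n -mulr_natl mulf_eq0 pnatr_eq0 /=.
by move/eqP.
Qed.

(** Cut [H, p H) into blocks of length 2H centred at multiples of 2H.  The
reflection of a block preserves g and changes the sign of k^M modulo four
times H, so twice the sum over the block is divisible by 4 H. *)
Lemma half_sum_block g H p : even_antiperiodic g H -> odd p -> (2 ^ n %| H)%N ->
  vge v n%:R (half_sum g (p * H) - half_sum g H).
Proof.
move=> ga op dH; rewrite -(odd_double_half p) op add1n; move: p./2 => q {op p}.
have [gv gN gF] := ga.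
elim: q => [|q IH]; first by rewrite double0 mul1n subrr; exact: vge0.
pose G (k : nat) := g k%:Z * (k%:Z ^+ M)%:~R.
pose a := (q.*2.+1 * H)%N; pose b := (q.*2.+3 * H)%N.
have ab : (a <= b)%N by rewrite leq_mul2r orbC leqW.
have -> : half_sum g (q.+1.*2.+1 * H) = half_sum g a + \sum_(a <= k < b) G k.
  by rewrite /half_sum -!(big_mkord xpredT G) -big_cat_nat.
rewrite addrAC; apply: (vgeD hv) => //.
have Godd t : G (t.*2.+1 * H)%N = 0.
  rewrite /G; have -> : (t.*2.+1 * H)%N%:Z = H%:Z + (t * H.*2)%N%:Z by lia.
  by rewrite (antiperiodic_mul _ _ ga) (even_antiperiodic_half ga) mulr0 mul0r.
have Ga : G a = 0 by exact: Godd.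
have Gb : G b = 0 by exact: (Godd q.+1).
have dab : ((2 : int) ^+ n.+1 %| (a + b)%N%:Z)%Z.
  rewrite dvdzE abszX /= /a /b.
  have -> : (q.*2.+1 * H + q.*2.+3 * H = 2 * H * (2 * q.+1))%N by lia.
  by rewrite dvdn_mulr// expnS dvdn_mul.
have S2 : \sum_(a <= k < b) G k + \sum_(a <= k < b) G k =
    \sum_(a <= k < b) g k%:Z * (k%:Z ^+ M + ((a + b)%N%:Z - k%:Z) ^+ M)%:~R.
  rewrite {2}(sum_nat_reflect ab Ga Gb) -big_split/=; apply: eq_big_nat => k /andP[ak kb].
  rewrite /G; have e : (a + b - k)%N%:Z = (a + b)%N%:Z - k%:Z by rewrite -subzn//; lia.
  rewrite e; have -> : g ((a + b)%N%:Z - k%:Z) = g k%:Z.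
    have -> : (a + b)%N%:Z - k%:Z = - k%:Z + (q.+1.*2 * H.*2)%N%:Z by rewrite /a /b; lia.
    by rewrite (antiperiodic_mul _ _ ga) gN -signr_odd odd_double mul1r.
  by rewrite intrD mulrDr.
have -> : \sum_(a <= k < b) G k =
   2^-1 * (\sum_(a <= k < b) G k + \sum_(a <= k < b) G k) by field.
have -> : n%:R = - 1 + n.+1%:R :> R by rewrite -natr1; ring.
apply: (vgeM hv); first by apply: veq_ge; apply: (v_inv hv); exact: v2.
rewrite S2; apply: (vge_sum hv) => k _; rewrite -[n.+1%:R]add0r; apply: (vgeM hv) => //.
apply: (vge_dvd2X hv); apply: dvdz_trans dab _.
have -> : k%:Z ^+ M + ((a + b)%N%:Z - k%:Z) ^+ M = ((a + b)%N%:Z - k%:Z) ^+ M - (- k%:Z) ^+ M.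
  by rewrite exprNn -signr_odd oM expr1; ring.
by rewrite subrXX; apply: dvdz_mulr; rewrite opprK subrK.
Qed.

Lemma sum_multiples (G : nat -> algC) p H : (0 < p)%N ->
  \sum_(k < p * H | (p %| k)%N) G k = \sum_(k < H) G (p * k)%N.
Proof.
move=> p0; rewrite -(big_mkord (fun k => p %| k)%N G) -(big_mkord xpredT (fun k => G (p * k)%N)).
elim: H => [|H IH]; first by rewrite muln0 !big_geq.
rewrite big_nat_recr//= -IH.
rewrite (@big_cat_nat _ _ _ (p * H) 0%N)//=; last by rewrite mulnS leq_addl.
suff -> : \sum_(p * H <= k < p * H.+1 | (p %| k)%N) G k = G (p * H)%N by [].
have pH : (p * H < p * H.+1)%N by rewrite ltn_pmul2l.
rewrite big_ltn_cond// dvdn_mulr// big_nat_cond big1 ?addr0//.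
move=> k /andP[/andP[k1 k2] /dvdnP[j Hj]].
by move: k1 k2; rewrite Hj [(j * p)%N]mulnC !ltn_pmul2l//; lia.
Qed.

Definition prime_to (p : nat) (g : int -> algC) (k : int) : algC :=
  if (p%:Z %| k)%Z then 0 else g k.

Lemma prime_to_antiperiodic p g H : odd p ->
  even_antiperiodic g H -> even_antiperiodic (prime_to p g) (p * H).
Proof.
move=> op ga; have [gv gN gF] := ga; split=> k; rewrite /prime_to.
- by case: ifP => // _; exact: vge0.
- by rewrite !dvdzE abszN gN.
- have -> : (p * H).*2%:Z = (p * H.*2)%:Z by lia.
  rewrite (antiperiodic_mul _ _ ga) -signr_odd op expr1 mulN1r.
  rewrite rpredDr; last by rewrite dvdzE /= dvdn_mulr.
  by case: ifP; rewrite ?oppr0.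
Qed.

(** The multiples of p in [0, p H) contribute g(p) p^M times the sum over [0, H),
and the full sum over [0, p H) reduces to the one over [0, H) by
[half_sum_block]. *)
Lemma half_sum_euler_factor p g H : odd p -> even_antiperiodic g H -> (2 ^ n %| H)%N ->
  (forall k, g (p%:Z * k) = g p%:Z * g k) ->
  vge v n%:R (half_sum (prime_to p g) (p * H) - (1 - g p%:Z * p%:R ^+ M) * half_sum g H).
Proof.
move=> op ga dH gM.
have -> : half_sum (prime_to p g) (p * H) = half_sum g (p * H) - g p%:Z * p%:R ^+ M * half_sum g H.
  apply/eqP; rewrite eq_sym subr_eq; apply/eqP.
  rewrite {1}/half_sum (bigID (fun k : 'I_(p * H) => (p %| k)%N))/= addrC; congr (_ + _).
    rewrite /half_sum [RHS](bigID (fun k : 'I_(p * H) => (p %| k)%N))/= [X in _ = X + _]big1 ?add0r; last first.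
      by move=> k pk; rewrite /prime_to dvdzE /= pk mul0r.
    by apply: eq_bigr => k /negbTE pk; rewrite /prime_to dvdzE /= pk.
  rewrite (sum_multiples (fun k => g k%:Z * (k%:Z ^+ M)%:~R)) ?odd_gt0//.
  rewrite /half_sum mulr_sumr; apply: eq_bigr => k _.
  by rewrite PoszM gM exprMn rmorphM !rmorphXn /=; ring.
by rewrite mulrBl mul1r opprB addrA subrK; exact: half_sum_block.
Qed.

(** Reindex one copy of the sum by [gauss_perm].  In each term g(pi k) equals
g(c k) up to sign, and the two integers that multiply it have the same parity,
so the term is twice an integral multiple of a value of g. *)
Lemma half_sum_twist g H c z : (0 < H)%N -> odd c -> coprime H.*2 c ->
  even_antiperiodic g H -> (forall k, vge v 1 (g k)) ->
  (forall k, g (c%:Z * k) = z * g k) ->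
  vge v 2 ((1 - z * c%:R ^+ M.+1) * half_sum g H).
Proof.
move=> H0 oc cop ga g1 gc; have [gv gN gF] := ga.
have [pi pi_inj Hpi] := gauss_perm H0 cop.
have -> : (1 - z * c%:R ^+ M.+1) * half_sum g H =
   \sum_(k < H) (g (pi k)%:Z * ((pi k)%:Z ^+ M)%:~R - g (c%:Z * k%:Z) * (c%:Z * (c%:Z * k%:Z) ^+ M)%:~R).
  rewrite mulrBl mul1r /half_sum {1}(reindex_inj pi_inj)/= mulr_sumr -sumrB; apply: eq_bigr => k _.
  by congr (_ - _); rewrite gc exprS exprMn !rmorphM !rmorphXn /=; ring.
apply: (vge_sum hv) => k _.
have [t Ht] := Hpi k.
have gpi : g (pi k)%:Z = (-1) ^+ t * g (c%:Z * k%:Z).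
  case: Ht => Ht.
    rewrite -PoszM Ht PoszD (antiperiodic_mul _ _ ga) mulrA -expr2 -exprM mulnC.
    by rewrite exprM sqrrN expr1n expr1n mul1r.
  have -> : (pi k)%:Z = - (c * k)%N%:Z + (t * H.*2)%N%:Z by rewrite -Ht PoszD; lia.
  by rewrite (antiperiodic_mul _ _ ga) gN PoszM.
have -> : g (pi k)%:Z * ((pi k)%:Z ^+ M)%:~R - g (c%:Z * k%:Z) * (c%:Z * (c%:Z * k%:Z) ^+ M)%:~R =
  g (c%:Z * k%:Z) * ((-1) ^+ t * (pi k)%:Z ^+ M - c%:Z * (c%:Z * k%:Z) ^+ M)%:~R.
  have sE : ((-1 : int) ^+ t)%:~R = (-1) ^+ t :> algC by rewrite rmorphXn /= rmorphN1.
  by rewrite gpi intrB (intrM _ ((-1) ^+ t)) sE; ring.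
apply: (vgeM hv) => //; apply: (vge_even hv).
have M0 : (0 < M)%N by case: (M) oM.
have parity : odd (pi k) = odd (c * k).
  by case: Ht => /(congr1 odd); rewrite !oddD [odd (t * _)]oddM odd_double andbF; do 2 case: odd.
have h : (2 %| (pi k)%:Z ^+ M + c%:Z * (c%:Z * k%:Z) ^+ M)%Z.
  rewrite -PoszM -!PoszX -PoszM -PoszD dvdzE absz_nat dvdn2.
  by rewrite oddD oddM !oddX !eqn0Ngt M0 /= oc parity addbb.
rewrite -signr_odd; case: (odd t); first by rewrite expr1 mulN1r -opprD rpredN.
rewrite mul1r; set x := _ ^+ M in h *; set y := c%:Z * _ in h *.
have -> : x - y = (x + y) - 2 * y by ring.
by rewrite rpredB// dvdz_mulr.
Qed.
End Sums.

(** * Even characters of conductor a power of two *)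

Lemma coprimez_2X (a : int) k : (0 < k)%N -> coprimez a (2 ^ k)%N = ~~ (2 %| a)%Z.
Proof.
by move=> k0; rewrite coprimezE /= coprime_pexpr// coprimen2 dvdzE /= dvdn2 negbK.
Qed.

Lemma exp2X_1D (f j : nat) (w : int) : ~~ (2 %| w)%Z ->
  exists2 w', ~~ (2 %| w')%Z & (1 + 2 ^+ f.+2 * w) ^+ (2 ^ j) = 1 + 2 ^+ (f + j).+2 * w' :> int.
Proof.
move=> ow; elim: j => [|j [w' ow' IH]]; first by exists w; rewrite // expr1 addn0.
exists (w' + 2 * (2 ^+ (f + j) * w' ^+ 2)).
  by rewrite rpredDr// dvdz_mulr.
rewrite expnSr exprM IH addnS !exprS; ring.
Qed.

Section Chi.
Variables (R : realType) (v : algC -> \bar R).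
Hypothesis hv : two_adic_valuation v.
Variables (n : nat) (chi : int -> algC).
Hypothesis n1 : (1 < n)%N.
Hypothesis hchi : cyclotomic_layer_character n chi.

Lemma chi_mod (a b : int) : (a = b %[mod (2 ^ n.+2)%N])%Z -> chi a = chi b.
Proof. by case: hchi => -[+ _ _ _] _ _ _; apply. Qed.

Lemma chiM : {morph chi : a b / a * b}. Proof. by case: hchi => -[]. Qed.
Lemma chi1 : chi 1 = 1. Proof. by case: hchi => -[]. Qed.

Lemma chiX a k : chi (a ^+ k) = chi a ^+ k.
Proof. by elim: k => [|k IH]; rewrite ?expr0 ?chi1// !exprS chiM IH. Qed.

Lemma chi_odd a : (chi a != 0) = ~~ (2 %| a)%Z.
Proof. by case: hchi => -[_ _ _ ->] _ _ _; rewrite coprimez_2X. Qed.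

Lemma chi_even a : (2 %| a)%Z -> chi a = 0.
Proof. by move=> ea; apply/eqP; rewrite -[_ == _]negbK chi_odd ea. Qed.

Lemma chiN a : chi (- a) = chi a.
Proof. by rewrite -mulN1r chiM; case: hchi => _ -> _ _; rewrite mul1r. Qed.

Lemma chi_unity a : ~~ (2 %| a)%Z -> chi a ^+ (2 ^ n) = 1.
Proof.
move=> oa; case: hchi => _ _ _ ord; apply: (ord (2 ^ n)%N).2 => //.
by rewrite coprimez_2X.
Qed.

Lemma chi_vge k : vge v 0 (chi k).
Proof.
have [ek|ok] := boolP (2 %| k)%Z; first by rewrite chi_even//; exact: vge0.
by apply/veq_ge/(v_unity_root hv _ (chi_unity ok)); rewrite expn_gt0.
Qed.

Lemma eqz_modP (a b : int) (m : nat) t : a = b + t * m%:Z -> (a = b %[mod m])%Z.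
Proof. by move=> ->; rewrite addrC modzMDl. Qed.

(** The square is 1, and the value 1 would make chi factor through the integers
modulo 2^(n+1). *)
Lemma chi_half : chi (1 + 2 ^+ n.+1) = -1.
Proof.
set w := chi _.
have w2 : w ^+ 2 = 1.
  rewrite -chiX -chi1; apply: chi_mod; apply: (@eqz_modP _ _ _ (1 + 2 ^+ n)).
  by rewrite PoszX !exprS; ring.
have /eqP : (w - 1) * (w + 1) = 0 by rewrite -subr_sqr w2 expr1n subrr.
rewrite mulf_eq0 => /orP[]; last by rewrite addr_eq0 => /eqP.
rewrite subr_eq0 => /eqP w1.
case: hchi => _ _ prim _.
exfalso; apply: (prim (2 ^ n.+1)%N).
- by rewrite dvdn_exp2l.
- by rewrite ltn_exp2l.
move=> a b; rewrite !coprimez_2X// => oa ob /eqP; rewrite eqz_mod_dvd => /dvdzP[t Ht].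
have aE : a = b + t * (2 ^ n.+1)%N%:Z by rewrite -Ht; ring.
have [et|ot] := boolP (2 %| t)%Z.
  have [s ts] := dvdzP et.
  apply: chi_mod; apply: (@eqz_modP _ _ _ s).
  by rewrite aE ts !PoszX !exprS; ring.
rewrite -[chi b]mulr1 -w1 -chiM; apply: chi_mod.
have [s Hs] : exists s, t = b + s * 2.
  exists ((t - b) %/ 2)%Z; have := divz_eq (t - b) 2.
  by move: ot ob; rewrite !dvdzE /=; lia.
by apply: (@eqz_modP _ _ _ s); rewrite aE Hs !PoszX !exprS; ring.
Qed.

Lemma chi_antiperiodic : even_antiperiodic v chi (2 ^ n).
Proof.
split; [exact: chi_vge|exact: chiN|move=> k].
have -> : (2 ^ n).*2%:Z = 2 ^+ n.+1 by rewrite -mul2n -expnS PoszX.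
have [ek|ok] := boolP (2 %| k)%Z.
  by rewrite !chi_even ?oppr0// rpredD// exprS dvdz_mulr.
rewrite -mulN1r -chi_half -chiM; apply: chi_mod.
have [s Hs] : exists s, k = 1 + s * 2.
  exists (k %/ 2)%Z; have := divz_eq k 2.
  by move: ok; rewrite !dvdzE /=; lia.
by apply: (@eqz_modP _ _ _ (- s)); rewrite Hs !PoszX !exprS; ring.
Qed.

(** Repeated squaring brings a to 1 + 2^(n+1) modulo 2^(n+2). *)
Lemma chi_exp_Nunit f (w : int) a : a = 1 + 2 ^+ f.+2 * w -> ~~ (2 %| w)%Z -> (f < n)%N ->
  chi a ^+ (2 ^ (n.-1 - f)) = -1.
Proof.
move=> -> ow fn; rewrite -chiX.
have [w' ow' ->] := exp2X_1D f (n.-1 - f) ow.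
have -> : (f + (n.-1 - f)).+2 = n.+1 by lia.
rewrite -chi_half; apply: chi_mod.
have [s Hs] : exists s, w' = 1 + s * 2.
  exists (w' %/ 2)%Z; have := divz_eq w' 2.
  by move: ow'; rewrite !dvdzE /=; lia.
by apply: (@eqz_modP _ _ _ s); rewrite Hs PoszX !exprS; ring.
Qed.

(** The factor b is congruent to 1 modulo 2, while 1 - chi(a) has valuation at
most 1/2. *)
Lemma v_euler_factor f (w : int) a b : a = 1 + 2 ^+ f.+2 * w -> ~~ (2 %| w)%Z ->
  (f.+1 < n)%N -> odd b -> v (1 - chi a * b%:R) = (2 ^+ f.+1 / 2 ^+ n)%:E.
Proof.
move=> aE ow fn ob.
have -> : 1 - chi a * b%:R = (1 - chi a) + chi a * (1 - b%:Z)%:~R.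
  by rewrite rmorphB /= ; ring.
have e : 2 ^+ f.+1 / 2 ^+ n = (2 ^+ (n.-1 - f))^-1 :> R.
  have {1}-> : n = (f.+1 + (n.-1 - f))%N by lia.
  by rewrite exprD invfM mulrA mulfV ?mul1r// expf_neq0.
rewrite e; apply: (@veqD _ _ hv _ _ _ 1).
- by apply: (v_one_minus_root hv); apply: chi_exp_Nunit aE ow _; lia.
- rewrite -[1]add0r; apply: (vgeM hv); first exact: chi_vge.
  by apply: (vge_even hv); rewrite dvdzE; have := ob; lia.
- rewrite invf_lt1 ?exprn_gt0// exprn_egt1 ?ltr1n//; lia.
Qed.

Lemma card_odd_ord k : #|[pred i : 'I_(2 ^ k.+1) | odd i]| = (2 ^ k)%N.
Proof.
rewrite -sum1_card (eq_bigl (fun i : 'I__ => odd i)); last by move=> i; rewrite inE.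
rewrite -(big_mkord (fun i => odd i) (fun=> 1%N)) expnS.
elim: (2 ^ k)%N => [|j IH]; first by rewrite muln0 big_geq.
have -> : (2 * j.+1 = (2 * j).+2)%N by lia.
rewrite big_mkcond big_nat_recr//= big_nat_recr//= -big_mkcond IH.
by rewrite oddM /= addn0 addn1.
Qed.

(** Compare the sum with its twist by chi(5) along [gauss_perm].  The terms where
the sign chi(pi k) / chi(5 k) is +1 cancel and the others, indexed by T, are
doubled.  The product of these signs over odd k is chi(5)^(- 2^(n-1)) = -1, so T
has an odd number of elements; each chi(5 k) being congruent to 1, the sum over
T is a unit. *)
Lemma v_sum_chi : v (\sum_(k < 2 ^ n) chi k%:Z) = (1 - 2 / 2 ^+ n)%:E.
Proof.
set Y := \sum_(k < _) _.
have n0 : (0 < n)%N by lia.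
have H0 : (0 < 2 ^ n)%N by rewrite expn_gt0.
have cop : coprime (2 ^ n).*2 5 by rewrite -mul2n -expnS coprimeXl.
have [pi pi_inj Hpi] := gauss_perm H0 cop.
have ga := chi_antiperiodic; have [_ gN gF] := ga.
have z5 : chi 5 ^+ (2 ^ n.-1) = -1.
  by have := @chi_exp_Nunit 0 1 5 erefl isT; rewrite subn0; apply; lia.
have pi_odd k : odd (pi k) = odd k.
  have [t []] := Hpi k; move/(congr1 odd);
  by rewrite ?oddD !oddM odd_double andbF /=; do 2 case: odd.
have chi5k k : chi (5 * k%:Z) = chi 5 * chi k%:Z by rewrite chiM.
have tau (k : 'I_(2 ^ n)) : chi (pi k)%:Z = chi (5 * k%:Z) \/ chi (pi k)%:Z = - chi (5 * k%:Z).
  have [t Ht] := Hpi k.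
  have -> : chi (pi k)%:Z = (-1) ^+ t * chi (5 * k%:Z).
    case: Ht => Ht.
      have -> : 5 * k%:Z = (pi k)%:Z + (t * (2 ^ n).*2)%N%:Z by rewrite -PoszD -Ht.
      by rewrite (antiperiodic_mul _ _ ga) mulrA -expr2 -exprM mulnC exprM sqrrN !expr1n mul1r.
    have -> : (pi k)%:Z = - (5 * k)%N%:Z + (t * (2 ^ n).*2)%N%:Z by rewrite -Ht PoszD; lia.
    by rewrite (antiperiodic_mul _ _ ga) gN.
  by rewrite -signr_odd; case: odd; rewrite ?mul1r ?mulN1r; [right|left].
pose T := [set k : 'I_(2 ^ n) | odd k && (chi (pi k)%:Z != chi (5 * k%:Z))]%SET.
have oddz (k : nat) : odd k -> ~~ (2 %| k%:Z)%Z by rewrite dvdzE /= dvdn2 => ->.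
have chi_n0 (k : nat) : odd k -> chi k%:Z != 0 by move=> ok; rewrite chi_odd oddz.
have Tneg k : k \in T -> chi (pi k)%:Z = - chi (5 * k%:Z).
  by rewrite inE => /andP[_ ne]; case: (tau k) => // e; rewrite e eqxx in ne.
have chi5_n0 (k : nat) : odd k -> chi (5 * k%:Z) != 0.
  by move=> ok; rewrite chi_odd -PoszM oddz// oddM.
have Todd : odd #|T|.
  have e1 : \prod_(k < 2 ^ n | odd k) chi (pi k)%:Z = \prod_(k < 2 ^ n | odd k) chi k%:Z.
    by rewrite [RHS](reindex_inj pi_inj)/=; apply: eq_bigl => k; rewrite pi_odd.
  have e2 : \prod_(k < 2 ^ n | odd k) chi (pi k)%:Z =
     (-1) ^+ #|T| * \prod_(k < 2 ^ n | odd k) chi (5 * k%:Z).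
    rewrite -prodr_const (bigID (fun k : 'I__ => k \in T) (fun k : 'I__ => odd k)) /=.
    rewrite [X in _ = _ * X](bigID (fun k : 'I__ => k \in T) (fun k : 'I__ => odd k)) /= mulrA.
    congr (_ * _).
      rewrite [X in _ = X * _](eq_bigl (fun k : 'I__ => odd k && (k \in T))); last first.
        by move=> k; rewrite inE; case: odd.
      by rewrite -big_split/=; apply: eq_bigr => k /andP[_ /Tneg->]; rewrite mulN1r.
    by apply: eq_bigr => k /andP[ok]; rewrite inE ok /= negbK => /eqP.
  have e3 : \prod_(k < 2 ^ n | odd k) chi (5 * k%:Z) = - \prod_(k < 2 ^ n | odd k) chi k%:Z.
    under eq_bigr do rewrite chi5k.
    rewrite big_split/= prodr_const.
    have -> : #|[pred k : 'I_(2 ^ n) | odd k]| = (2 ^ n.-1)%N.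
      by rewrite -(card_odd_ord n.-1) prednK.
    by rewrite z5 mulN1r.
  have Q0 : \prod_(k < 2 ^ n | odd k) chi k%:Z != 0.
    by apply/prodf_neq0 => k ok; exact: chi_n0.
  move: e2; rewrite e1 e3 -signr_odd; case: (odd _) => //.
  rewrite expr0 mul1r => /eqP; rewrite -addr_eq0 -mulr2n -mulr_natl mulf_eq0 pnatr_eq0 /=.
  by rewrite (negbTE Q0).
have key : (1 - chi 5) * Y = - 2 * \sum_(k in T) chi (5 * k%:Z).
  rewrite mulrBl mul1r /Y {1}(reindex_inj pi_inj)/= mulr_sumr -sumrB mulr_sumr.
  rewrite [RHS]big_mkcond/=; apply: eq_bigr => k _; rewrite -chi5k.
  case: ifP => kT; first by rewrite Tneg//; ring.
  have [ok|ek] := boolP (odd k).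
    by move: kT; rewrite inE ok /= => /negbFE/eqP->; rewrite subrr.
  by rewrite !chi_even ?subrr// dvdzE /= ?dvdn_mull// dvdn2 ?pi_odd.
have vsum : v (\sum_(k in T) chi (5 * k%:Z)) = 0%:E.
  have -> : \sum_(k in T) chi (5 * k%:Z) = (#|T|%:Z)%:~R + \sum_(k in T) (chi (5 * k%:Z) - 1).
    by rewrite sumrB sumr_const -pmulrn; ring.
  apply: (@veqD _ _ hv _ _ _ (2 ^+ n)^-1).
  - by apply: (v_odd hv); rewrite dvdzE /= dvdn2 Todd.
  - apply: (vge_sum hv) => k; rewrite inE => /andP[ok _].
    apply: (vge_unity_root_sub1 hv); apply: chi_unity.
    by rewrite -PoszM oddz// oddM.
  - by rewrite invr_gt0 exprn_gt0.
have v5 : v (1 - chi 5) = (2 / 2 ^+ n)%:E.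
  have := @v_euler_factor 0 1 5 1 erefl isT n1 isT.
  by rewrite mulr1 expr1.
have vp : v ((1 - chi 5) * Y) = 1%:E.
  have v2N : v (- 2) = 1%:E by rewrite (vN hv); exact: v2.
  by rewrite key; have := veqM hv v2N vsum; rewrite addr0.
have Y0 : Y != 0 by have := v_neq0 hv vp; rewrite mulf_eq0 negb_or => /andP[].
have [b Eb] := v_fin hv Y0.
have := veqM hv v5 Eb; rewrite vp => -[] e1.
by rewrite Eb; congr EFin; lra.
Qed.
End Chi.

(** * The quadratic character and the exponents of the prime divisors *)

(** A completely multiplicative function is trivial at N if it is trivial at the
prime divisors of N. *)
Lemma multiplicative_eq1 (f : nat -> algC) N : (0 < N)%N -> f 1%N = 1 ->
  (forall a b, f (a * b)%N = f a * f b) ->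
  (forall q, prime q -> (q %| N)%N -> f q = 1) -> f N = 1.
Proof.
move=> + f1 fM; elim/ltn_ind: N => N IH N0 Hq.
have [N1|N1] := leqP N 1; first by have -> : N = 1%N by lia.
have pq := pdiv_prime N1; have dq := pdiv_dvd N.
have [k Hk] := dvdnP dq.
have k0 : (0 < k)%N by move: N0; rewrite Hk; case: (k).
rewrite Hk fM (Hq _ pq dq) mulr1; apply: IH => //.
  by rewrite Hk ltn_Pmulr// prime_gt1.
by move=> q Pq qk; apply: Hq => //; rewrite Hk dvdn_mulr.
Qed.

Section Psi.
Variables (d : nat) (psi : int -> algC).
Hypotheses (d1 : (1 < d)%N) (od : odd d).
Hypothesis hpsi : quadratic_field_character d psi.
Let D := quadratic_disc d.

Lemma psiM : {morph psi : a b / a * b}. Proof. by case: hpsi => -[]. Qed.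
Lemma psi1 : psi 1 = 1. Proof. by case: hpsi => -[]. Qed.

Lemma disc_dvd : (D %| 4 * d)%N.
Proof. by rewrite /D /quadratic_disc; case: ifP => _ //; rewrite dvdn_mull. Qed.

Lemma dvd_disc : (d %| D)%N.
Proof. by rewrite /D /quadratic_disc; case: ifP => _ //; rewrite dvdn_mull. Qed.

Lemma psi_mod4 (k t : int) : psi (k + t * (4 * d)%N%:Z) = psi k.
Proof.
case: hpsi => -[per _ _ _] _; apply: per; have [w ->] := dvdnP disc_dvd.
by rewrite PoszM mulrA addrC modzMDl.
Qed.

Lemma psi_unit a : (psi a != 0) = coprimez a D.
Proof. by case: hpsi => -[]. Qed.

Lemma psi_prime_sqr q : prime q -> ~~ (q %| D)%N -> psi q%:Z ^+ 2 = 1.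
Proof.
by move=> pq qD; case: hpsi => _ /(_ q pq qD) ->; case: ifP; rewrite ?sqrrN expr1n.
Qed.

Lemma psi_sqr a : coprimez a D -> psi a ^+ 2 = 1.
Proof.
rewrite -psi_unit => a0.
have D0 : (0 < D)%N by rewrite /D /quadratic_disc; case: ifP; lia.
have D0' : D%:Z != 0 by rewrite eqz_nat -lt0n.
have aE : psi a = psi (absz (a %% D)%Z)%:Z.
  by case: hpsi => -[per _ _ _] _; rewrite gez0_abs ?modz_ge0//; apply: per; rewrite modz_mod.
rewrite aE in a0 *; move: (absz _) a0 => N N0.
have cN : coprime N D by have := N0; rewrite psi_unit.
apply: (@multiplicative_eq1 (fun k => psi k%:Z ^+ 2)).
- rewrite lt0n; apply/eqP => N00; move: cN; rewrite N00 /coprime gcd0n => /eqP D1.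
  by have := dvdn_leq D0 dvd_disc; rewrite D1; lia.
- by rewrite psi1 expr1n.
- by move=> x y; rewrite PoszM psiM exprMn.
move=> q pq qN; apply: psi_prime_sqr => //.
apply/negP => qD; have : (q %| gcdn N D)%N by rewrite dvdn_gcd qN.
by rewrite (eqP cN) dvdn1 => /eqP q1; rewrite q1 in pq.
Qed.

(** Evaluate psi at 4 d - 1, which is -1 modulo the discriminant: modulo a prime
divisor q of 4 d - 1 the integer 2 d is a square root of d, so q splits.  This
replaces an appeal to quadratic reciprocity. *)
Lemma psi_neg1 : psi (-1) = 1.
Proof.
have -> : psi (-1) = psi (4 * d).-1%:Z.
  rewrite -(psi_mod4 (-1) 1); congr psi; lia.
apply: (@multiplicative_eq1 (fun k => psi k%:Z)); [lia|exact: psi1|by move=> x y; rewrite PoszM psiM|].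
move=> q pq qN.
have q4d : coprime q (4 * d).
  rewrite prime_coprime//; apply/negP => q4d.
  have : (q %| 4 * d - (4 * d).-1)%N by rewrite dvdn_sub.
  have -> : (4 * d - (4 * d).-1 = 1)%N by lia.
  by rewrite dvdn1 => /eqP q1; rewrite q1 in pq.
have qD : ~~ (q %| D)%N.
  rewrite -prime_coprime//; exact: coprime_dvdr disc_dvd q4d.
have qd : ~~ (q %| d)%N.
  by rewrite -prime_coprime//; move: q4d; rewrite coprimeMr => /andP[].
have q2 : q != 2%N.
  by apply/eqP => q2; move: q4d; rewrite q2 coprimeMr.
case: hpsi => _ /(_ q pq qD) ->; rewrite /splits_in_quadratic (negbTE q2) /legendre.
rewrite dvdzE /= (negbTE qd).
have q0 := prime_gt0 pq.
have rq : ((2 * d) %% q < q)%N by rewrite ltn_mod.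
suff -> : [exists x : 'I_q, ((x : nat)%:Z ^+ 2 == d%:Z %[mod q])%Z] by [].
apply/existsP; exists (Ordinal rq) => /=.
rewrite -PoszX eqz_mod_dvd; apply/dvdzP.
have [k Hk] := dvdnP qN; have e := divn_eq (2 * d) q.
set r := ((2 * d) %% q)%N in e *; set t := ((2 * d) %/ q)%N in e.
exists (k%:Z * d%:Z - t%:Z * (r%:Z + (2 * d)%N%:Z)).
have rE : r%:Z = (2 * d)%N%:Z - t%:Z * q%:Z by rewrite {1}e PoszD PoszM; ring.
have kE : (4 * d)%N%:Z - 1 = k%:Z * q%:Z by rewrite -PoszM -Hk; lia.
have kE' : k%:Z * d%:Z * q%:Z = d%:Z * ((4 * d)%N%:Z - 1) by rewrite kE; ring.
by rewrite mulrBl kE' PoszX rE !PoszM; ring.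
Qed.
End Psi.

(** If p = 3 modulo 4, a square root of -1 would contradict the little theorem of
Fermat.  If p = 1 modulo 4 and no square root existed, y^((p-1)/2) would be 1
for every nonzero y, which gives this polynomial too many roots. *)
Lemma legendre_neg1 (p : nat) : prime p -> odd p ->
  legendre (-1) p = if (p %% 4 == 1)%N then 1 else -1.
Proof.
move=> pp op; rewrite /legendre dvdzE /= dvdn1.
have p1 := prime_gt1 pp; rewrite gtn_eqF//.
have p2 : p != 2%N by apply/eqP => e; move: op; rewrite e.
have sqE (x : nat) : (x%:Z ^+ 2 == -1 %[mod p])%Z = ((x%:R : 'F_p) ^+ 2 == -1).
  rewrite -PoszX eqz_mod_dvd.
  have -> : (x ^ 2)%N%:Z - -1 = (x ^ 2 + 1)%N%:Z by rewrite PoszD opprK.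
  by rewrite dvdzE absz_nat (dvdn_pcharf (pchar_Fp pp)) natrD natrX addr_eq0.
have fermat (y : 'F_p) : y != 0 -> y ^+ p.-1 = 1.
  move=> y0; apply: (mulfI y0); rewrite -exprS prednK ?prime_gt0//.
  by rewrite mulr1; have := expf_card y; rewrite card_Fp.
have modp := modn2 p; rewrite op in modp.
case: (eqVneq (p %% 4)%N 1%N) => p4; last first.
  have p3 : p = (4 * (p %/ 4) + 3)%N by lia.
  case: ifP => // /existsP[x]; rewrite sqE => /eqP x2.
  have x0 : (nat_of_ord x)%:R != 0 :> 'F_p.
    by apply/eqP => x0; move: x2; rewrite x0 expr0n /= => /esym/eqP; rewrite oppr_eq0 oner_eq0.
  have := fermat _ x0.
  have -> : p.-1 = (2 * (2 * (p %/ 4) + 1))%N by lia.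
  rewrite exprM x2 addn1 exprS exprM sqrrN !expr1n mulr1 => /eqP.
  rewrite eq_sym -addr_eq0 -[1 + 1]/(2%:R) -(dvdn_pcharf (pchar_Fp pp)) => /dvdn_leq; lia.
rewrite ifT//; apply/existsP.
pose q := (p %/ 4)%N; have pE : p = (4 * q + 1)%N by rewrite /q; lia.
suff [y y2] : exists y : 'F_p, y ^+ 2 = -1.
  have rq : ((y : nat) %% p < p)%N by rewrite ltn_mod prime_gt0.
  by exists (Ordinal rq); rewrite sqE /= Fp_nat_mod// natr_Zp y2.
apply: contrapT => no.
have all1 (y : 'F_p) : y != 0 -> y ^+ (2 * q) = 1.
  move=> y0; have : y ^+ (2 * q) ^+ 2 = 1.
    by rewrite -exprM -(fermat y y0); congr (_ ^+ _); lia.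
  move/eqP; rewrite sqrf_eq1 => /orP[/eqP//|/eqP yq]; case: no; exists (y ^+ q).
  by rewrite -exprM mulnC.
have q0 : (0 < q)%N by lia.
have : (size (enum (predC1 (0%R : 'F_p))) < size ('X^(2 * q) - 1%:P : {poly 'F_p})%R)%N.
  apply: max_poly_roots; last exact: enum_uniq.
    by rewrite -size_poly_eq0 size_XnsubC// muln_gt0.
  apply/allP => y; rewrite mem_enum => y0; rewrite rootE hornerD hornerN hornerC hornerXn.
  by rewrite all1 ?subrr.
rewrite size_XnsubC ?muln_gt0// -cardE cardC1 card_Fp//.
by rewrite pE; lia.
Qed.

(** By choice of the sign p* = 1 modulo 4, and then f_p + 2 is the exact power
of 2 in p* - 1. *)
Lemma pstarE (p : nat) : prime p -> odd p ->
  exists2 w : int, ~~ (2 %| w)%Z & pstar p = 1 + 2 ^+ (fexp p).+2 * w.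
Proof.
move=> pp op; have modp := modn2 p; rewrite op in modp.
have p1 := prime_gt1 pp.
have [u Hu] : exists u, pstar p = 1 + 4 * u.
  rewrite /pstar legendre_neg1//; case: (eqVneq (p %% 4)%N 1%N) => p4.
    by exists (p %/ 4)%N%:Z; rewrite mul1r {1}(divn_eq p 4) p4; lia.
  by exists (- (p %/ 4)%N%:Z - 1); have := divn_eq p 4; lia.
have u0 : u != 0.
  apply/eqP => u0; move: Hu; rewrite u0 mulr0 addr0 /pstar legendre_neg1//.
  by case: ifP => _; lia.
have fE : fexp p = logn 2 `|u| by rewrite /fexp Hu addrAC subrr add0r mulKz.
have u0' : (0 < `|u|)%N by rewrite absz_gt0.
have dz : ((2 : int) ^+ (fexp p) %| u)%Z by rewrite dvdzE abszX fE pfactor_dvdnn.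
have [w Hw] := dvdzP dz; exists w; last by rewrite Hu Hw !exprS; ring.
rewrite dvdzE; apply/negP => dw.
have : (2 ^ (fexp p).+1 %| `|u|)%N by rewrite Hw abszM abszX mulnC expnSr dvdn_mul.
by rewrite pfactor_dvdn// -fE ltnn.
Qed.

Lemma nbound_le (R : realType) (d n : nat) : (1 < d)%N -> nbound R d <= n%:Z ->
  ((fmax d).+1 < n)%N /\ (size (primes d) * 2 ^ (fmax d).+2 <= 2 ^ n)%N.
Proof.
move=> d1; rewrite /nbound => h.
set f := fmax d; set t := size (primes d).
have t0 : (0 < t)%N.
  by rewrite /t -has_predT; apply/hasP; exists (pdiv d) => //; rewrite mem_primes pdiv_prime// pdiv_dvd; lia.
have l2 : 0 < ln (2 : R) by apply: ln_gt0; rewrite ltr1n.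
have lt0 : 0 <= ln (t%:R : R) by apply: ln_ge0; rewrite ler1n.
have h1 : f%:R + ln (t%:R : R) / ln 2 + 2 <= n%:R.
  by apply: le_trans (ceil_ge _) _; rewrite -[n%:R]/(n%:Z%:~R) ler_int.
have h2 : 0 <= ln (t%:R : R) / ln 2 by rewrite divr_ge0// ltW.
have fn : (f.+2 <= n)%N by rewrite -(ler_nat R) -addn2 natrD; lra.
split => //.
have h3 : ln (t%:R : R) <= (n - f.+2)%:R * ln 2.
  have -> : (n - f.+2)%:R = n%:R - f%:R - 2 :> R by rewrite natrB// -addn2 natrD; ring.
  by rewrite -ler_pdivrMr//; lra.
have h4 : (t <= 2 ^ (n - f.+2))%N.
  rewrite -(ler_nat R) natrX -ler_ln ?posrE ?exprn_gt0 ?ltr0n//.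
  by rewrite lnXn ?ltr0n//; move: h3; rewrite mulr_natl.
by rewrite -(subnK fn) expnD leq_mul2r h4 orbT.
Qed.

(** * The valuation of the L-value *)

Lemma prod_primes_squarefree d : (0 < d)%N -> squarefree d ->
  (\prod_(p <- primes d) p)%N = d.
Proof.
move=> d0 sq; rewrite [RHS](prod_prime_decomp d0) prime_decompE big_map.
rewrite big_seq [RHS]big_seq; apply: eq_bigr => p /=; rewrite mem_primes => /and3P[pp _ pd].
have l1 : (0 < logn p d)%N by rewrite logn_gt0 mem_primes pp d0.
have l2 : (logn p d < 2)%N by rewrite ltnNge -pfactor_dvdn// sq.
by rewrite (_ : logn p d = 1%N)//; lia.
Qed.

Section Main.
Variables (R : realType) (v : algC -> \bar R).
Hypothesis hv : two_adic_valuation v.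
Variables (n : nat) (chi : int -> algC).
Hypothesis n1 : (1 < n)%N.
Hypothesis hchi : cyclotomic_layer_character n chi.
Variable M : nat.
Hypothesis oM : odd M.

Let chiM' := chiM hchi.
Let chi_anti := chi_antiperiodic hv n1 hchi.

Lemma fold_prime_toE s k :
  foldr prime_to chi s k = if has (fun p : nat => (p%:Z %| k)%Z) s then 0 else chi k.
Proof. by elim: s => [|p s IH] //=; rewrite /prime_to IH; case: ifP. Qed.

Lemma fold_prime_to_antiperiodic s : all odd s ->
  even_antiperiodic v (foldr prime_to chi s) (\prod_(p <- s) p * 2 ^ n).
Proof.
elim: s => [|p s IH] /=; first by rewrite big_nil mul1n.
move=> /andP[op os]; rewrite big_cons -mulnA.
have := IH os; move/(prime_to_antiperiodic hv op); exact.
Qed.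

(** Induction on the list of primes; a prime outside the list s does not affect
divisibility by the primes of s, so the restricted character is still
multiplicative at p. *)
Lemma half_sum_fold_euler s : all odd s -> all prime s -> uniq s ->
  vge v n%:R (half_sum M (foldr prime_to chi s) (\prod_(p <- s) p * 2 ^ n)
     - \prod_(p <- s) (1 - chi p%:Z * p%:R ^+ M) * half_sum M chi (2 ^ n)).
Proof.
elim: s => [|p s IH] /=; first by rewrite !big_nil mul1n mul1r subrr => *; exact: vge0.
move=> /andP[op os] /andP[pp ps] /andP[pns us]; rewrite !big_cons -mulnA.
set g := foldr _ _ s; set H := (_ * 2 ^ n)%N; set E := \prod_(q <- s) _.
have ga : even_antiperiodic v g H by exact: fold_prime_to_antiperiodic.
have q_dvd q k : q \in s -> (q%:Z %| p%:Z * k)%Z = (q%:Z %| k)%Z.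
  move=> qs; rewrite Gauss_dvdzr// coprimezE /= prime_coprime ?(allP ps)//.
  apply/negP => qp; have := prime_nt_dvdP pp _ qp => /(_ _)/eqP.
  by case: eqP => [q1|_]; [move: (allP ps _ qs); rewrite q1|move/(_ isT)/eqP => qp'; rewrite -qp' qs in pns].
have gpE k : g (p%:Z * k) = chi p%:Z * g k.
  rewrite /g !fold_prime_toE.
  have -> : has (fun q : nat => (q%:Z %| p%:Z * k)%Z) s = has (fun q : nat => (q%:Z %| k)%Z) s.
    by apply: eq_in_has => q qs; exact: q_dvd.
  by case: ifP; rewrite ?mulr0// chiM'.
have gp : g p%:Z = chi p%:Z.
  rewrite /g fold_prime_toE ifN//; apply/hasPn => q qs.
  rewrite -[p%:Z]mulr1 q_dvd// dvdz1 /=; apply/negP => /eqP q1.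
  by have := allP ps _ qs; rewrite q1.
have gM k : g (p%:Z * k) = g p%:Z * g k by rewrite gp gpE.
have dH : (2 ^ n %| H)%N by rewrite dvdn_mull.
have h1 := @half_sum_euler_factor _ v hv M n oM p g H op ga dH gM.
have h2 := IH os ps us.
set c := 1 - chi p%:Z * p%:R ^+ M; rewrite gp -/c in h1.
have -> : half_sum M (prime_to p g) (p * H) - c * E * half_sum M chi (2 ^ n) =
   (half_sum M (prime_to p g) (p * H) - c * half_sum M g H) + c * (half_sum M g H - E * half_sum M chi (2 ^ n)).
  by ring.
apply: (vgeD hv) => //; rewrite -[n%:R]add0r; apply: (vgeM hv) => //.
apply: (vgeB hv); first by rewrite /vge (v1 hv).
rewrite -[0]addr0; apply: (vgeM hv); first exact: (chi_vge hv hchi).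
by rewrite -natrX; exact: (vge_nat hv).
Qed.

(** For odd k the power k^M is odd, so modulo 2 the exponent M can be dropped. *)
Lemma v_half_sum_chi : v (half_sum M chi (2 ^ n)) = (1 - 2 / 2 ^+ n)%:E.
Proof.
have -> : half_sum M chi (2 ^ n) = \sum_(k < 2 ^ n) chi k%:Z
     + \sum_(k < 2 ^ n) chi k%:Z * (k%:Z ^+ M - 1)%:~R.
  rewrite /half_sum -big_split/=; apply: eq_bigr => k _.
  by rewrite intrB; ring.
apply: (@veqD _ _ hv _ _ _ 1).
- exact: (v_sum_chi hv n1 hchi).
- apply: (vge_sum hv) => k _.
  have [ek|ok] := boolP (2 %| k%:Z)%Z.
    by rewrite (chi_even hchi)// mul0r; exact: vge0.
  rewrite -[1]add0r; apply: (vgeM hv); first exact: (chi_vge hv hchi).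
  apply: (vge_even hv); rewrite subrX1; apply: dvdz_mulr.
  by move: ok; rewrite !dvdzE /=; lia.
- by rewrite ltrBlDr ltrDl divr_gt0// exprn_gt0.
Qed.

Lemma v_prod_euler (s : seq nat) :
  (forall p, p \in s -> [/\ prime p, odd p & ((fexp p).+1 < n)%N]) ->
  v (\prod_(p <- s) (1 - chi p%:Z * p%:R ^+ M)) = (\sum_(p <- s) 2 ^+ (fexp p).+1 / 2 ^+ n)%:E.
Proof.
elim: s => [|p s IH] H; first by rewrite !big_nil (v1 hv).
rewrite !big_cons; apply: (veqM hv); last first.
  by apply: IH => q qs; apply: H; rewrite inE qs orbT.
have [pp op fn] := H p (mem_head _ _).
have [w ow pE] := pstarE pp op.
have -> : chi p%:Z = chi (pstar p).
  rewrite /pstar legendre_neg1//; case: ifP => _; first by rewrite mul1r.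
  by rewrite mulN1r (chiN hchi).
rewrite -natrX; apply: (v_euler_factor hv n1 hchi pE ow fn).
by rewrite oddX op orbT.
Qed.
End Main.

Theorem corollary3p10 (R : realType)
  (iota : {rmorphism algC -> R[i]})
  (v : algC -> \bar R) (hv : two_adic_valuation v)
  (d : nat) (d_gt1 : (1 < d)%N) (d_odd : odd d) (d_sqf : squarefree d)
  (m : nat) (m_gt0 : (0 < m)%N) (m_even : ~~ odd m)
  (n : nat) (hn : nbound R d <= n%:Z)
  (chi : int -> algC) (hchi : cyclotomic_layer_character n chi)
  (psi : int -> algC) (hpsi : quadratic_field_character d psi)
  (L : R[i] -> R[i])
  (hL : dirichlet_L_function (fun k : int => iota (chi k * psi k)) L) :
  exists2 x : algC, iota x = L (1 - m%:R) &
    v x = (1 + 2 ^ (1 - n%:Z)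
               * (- 1 + \sum_(p <- primes d) 2 ^+ fexp p))%:E.
Proof.
have [fn taun] := nbound_le d_gt1 hn.
have n1 : (1 < n)%N by lia.
have d0 : (0 < d)%N by lia.
pose M := m.-1; have oM : odd M by rewrite /M; lia.
pose H := (d * 2 ^ n)%N.
have H0 : (0 < H)%N by rewrite muln_gt0 d0 expn_gt0.
have dH : (2 ^ n %| H)%N by rewrite dvdn_mull.
have chi_anti := chi_antiperiodic hv n1 hchi.
have [chi_v chi_N chi_F] := chi_anti.
have psi_N k : psi (- k) = psi k by rewrite -mulN1r (psiM hpsi) (psi_neg1 d_gt1 d_odd hpsi) mul1r.
have psi_v k : vge v 0 (psi k).
  have [->|pk] := eqVneq (psi k) 0; first exact: vge0.
  apply/veq_ge/(@v_unity_root _ _ hv _ 2) => //.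
  by apply: (psi_sqr d_gt1 d_odd hpsi); rewrite -(psi_unit hpsi).
pose g k := chi k * psi k.
have ga : even_antiperiodic v g H.
  split=> k; rewrite /g.
  - by rewrite -[0]addr0; apply: (vgeM hv).
  - by rewrite chi_N psi_N.
  have -> : k + H.*2%:Z = k + (d * (2 ^ n).*2)%N%:Z by rewrite /H; lia.
  rewrite (antiperiodic_mul _ _ chi_anti) -signr_odd d_odd expr1 mulN1r mulNr.
  congr (- (_ * _)); rewrite -(psi_mod4 hpsi k (2 ^+ n.-1)); congr (psi (_ + _)).
  have e : (2 ^ n = 2 * 2 ^ n.-1)%N by rewrite -expnS prednK// ltnW.
  by rewrite -PoszX -PoszM e; congr Posz; rewrite -muln2; ring.
have [gv gN gF] := ga.
have g0 : g 0 = 0 by rewrite /g (chi_even hchi) ?mul0r.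
pose x := regularized_sum g H M.+4 'X^M.
exists x.
  have -> : 1 - m%:R = - M%:R :> R[i] by rewrite -(prednK m_gt0) -natr1 opprD addrC subrK.
  have F0 : (0 < H.*2)%N by rewrite double_gt0.
  rewrite (L_value_antiperiodic M hL F0); last by move=> k; rewrite -rmorphN -gF.
  rewrite /x /regularized_sum rmorph_sum; apply: eq_bigr => i _.
  rewrite rmorphM fmorphV rmorphXn rmorph_nat; congr (_ * _).
  rewrite rmorph_sum; apply: eq_bigr => k _.
  by rewrite rmorphM rmorph_int.
pose s := primes d; pose g1 := foldr prime_to chi s.
have sP p : p \in s -> [/\ prime p, odd p & ((fexp p).+1 < n)%N].
  rewrite mem_primes => /and3P[pp _ pd]; split => //.
    by apply: dvdn_odd pd d_odd.
  apply: leq_ltn_trans fn; rewrite ltnS.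
  by apply: leq_bigmax_seq => //; rewrite mem_primes pp d0.
have so : all odd s by apply/allP => p /sP[].
have sp : all prime s by apply/allP => p /sP[].
have HE : (\prod_(p <- s) p * 2 ^ n)%N = H by rewrite prod_primes_squarefree.
have g1a : even_antiperiodic v g1 H by rewrite -HE; exact: fold_prime_to_antiperiodic.
have [g1v g1N g1F] := g1a.
pose delta k := g k - g1 k.
have has_cop k : has (fun p : nat => (p%:Z %| k)%Z) s = ~~ coprimez k d.
  rewrite coprimezE /=; apply/idP/idP.
    move=> /hasP[p ps pk]; have [pp _ _] := sP p ps; apply/negP => /eqP cop.
    have : (p %| gcdn `|k| d)%N.
      by rewrite dvdn_gcd; move: ps pk; rewrite mem_primes dvdzE /= => /and3P[_ _ ->] ->.
    by rewrite cop dvdn1 => /eqP p1; rewrite p1 in pp.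
  move=> ncop; have gt1 : (1 < gcdn `|k| d)%N.
    by rewrite ltn_neqAle eq_sym ncop gcdn_gt0 d0 orbT.
  apply/hasP; exists (pdiv (gcdn `|k| d)).
    rewrite mem_primes pdiv_prime// d0 /=.
    exact: dvdn_trans (pdiv_dvd _) (dvdn_gcdr _ _).
  by rewrite dvdzE /=; exact: dvdn_trans (pdiv_dvd _) (dvdn_gcdl _ _).
have delta_a : even_antiperiodic v delta H.
  split=> k; rewrite /delta.
  - exact: (vgeB hv).
  - by rewrite gN g1N.
  - by rewrite gF g1F opprD.
(* psi is 1 or -1 on the integers prime to 2 d. *)
have delta1 k : vge v 1 (delta k).
  rewrite /delta /g1 fold_prime_toE has_cop.
  have [ek|ok] := boolP (2 %| k)%Z.
    by rewrite /g (chi_even hchi)// mul0r if_same subrr; exact: vge0.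
  have [kd|kd] := boolP (coprimez k d) => /=; last first.
    rewrite subr0 /g; suff -> : psi k = 0 by rewrite mulr0; exact: vge0.
    apply/eqP; rewrite -[_ == _]negbK (psi_unit hpsi); apply: contra kd.
    rewrite !coprimezE /=; apply: coprime_dvdr; exact: dvd_disc.
  have : psi k ^+ 2 = 1.
    apply: (psi_sqr d_gt1 d_odd hpsi).
    rewrite coprimezE; apply: (coprime_dvdr (disc_dvd d)); rewrite coprimeMr.
    by move: ok kd; rewrite !coprimezE dvdzE /= dvdn2 negbK -[4%N]/(2 ^ 2)%N coprime_pexpr// coprimen2 => -> ->.
  move/eqP; rewrite sqrf_eq1 /g => /orP[/eqP->|/eqP->].
    by rewrite mulr1 subrr; exact: vge0.
  have -> : chi k * -1 - chi k = chi k * - 2 by ring.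
  rewrite -[1]add0r; apply: (vgeM hv) => //.
  by rewrite (vgeN hv); apply: veq_ge; exact: v2.
(* This c is 5 modulo 8, so that chi(c) generates the values of chi, and 1 modulo
   4 d, so that psi(c) = 1 and the same factor serves for g and g1. *)
pose c := (4 * d).+1.
have cz : c%:Z = 1 + 2 ^+ 2 * d%:Z by rewrite /c; lia.
have od2 : ~~ (2 %| d%:Z)%Z by rewrite dvdzE /= dvdn2 negbK.
have dc : coprime d c by rewrite /c -addn1 /coprime gcdnMDl gcdn1.
have cop : coprime H.*2 c.
  have c2 : coprime 2 c by rewrite coprime2n /c; lia.
  by rewrite /H -mul2n !coprimeMl c2 dc coprimeXl.
have psi_c k : psi (c%:Z * k) = psi k.
  rewrite (psiM hpsi); suff -> : psi c%:Z = 1 by rewrite mul1r.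
  by rewrite -(psi1 hpsi) -(psi_mod4 hpsi 1 1); congr psi; rewrite /c; lia.
have delta_c k : delta (c%:Z * k) = chi c%:Z * delta k.
  rewrite /delta /g /g1 !fold_prime_toE !has_cop psi_c (chiM hchi).
  have -> : coprimez (c%:Z * k) d = coprimez k d.
    rewrite !coprimezE abszM coprimeMl /=.
    suff -> : coprime c d by [].
    by rewrite coprime_sym.
  by case: ifP => _; ring.
have oc : odd c by rewrite /c; lia.
have tw := half_sum_twist hv oM H0 oc cop delta_a delta1 delta_c.
set W := 1 - chi c%:Z * c%:R ^+ M.+1 in tw.
have vW : v W = (2 / 2 ^+ n)%:E.
  rewrite /W -natrX (v_euler_factor hv n1 hchi (f := 0) cz od2 n1) ?expr1//.
  by rewrite oddX /c; lia.
pose S := \sum_(p <- s) (2 ^+ (fexp p).+1 / 2 ^+ n) : R.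
(* This is where the lower bound on n enters. *)
have S12 : S <= 2^-1.
  have : S <= \sum_(p <- s) (2 ^+ (fmax d).+1 / 2 ^+ n).
    rewrite /S big_seq [leRHS]big_seq; apply: ler_sum => p ps.
    rewrite ler_pM2r ?invr_gt0 ?exprn_gt0// ler_weXn2l ?ler1n// ltnS.
    exact: leq_bigmax_seq.
  move/le_trans; apply.
  rewrite big_const_seq count_predT iter_addr_0.
  rewrite -[_ *+ size s]mulr_natl mulrA ler_pdivrMr ?exprn_gt0//.
  move: taun; rewrite -(ler_nat R) natrM !natrX [2 ^+ _.+2]exprS -/s; lra.
have t0 : 0 < 2 / 2 ^+ n :> R by rewrite divr_gt0// exprn_gt0.
have n2 : 2 <= n%:R :> R by rewrite ler_nat.
have vE := v_prod_euler hv n1 hchi M sP.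
have vg1 : v (half_sum M g1 H) = (S + (1 - 2 / 2 ^+ n))%:E.
  have := half_sum_fold_euler hv n1 hchi oM so sp (primes_uniq d); rewrite HE => h.
  have vEY := veqM hv vE (v_half_sum_chi hv n1 hchi oM).
  have -> : half_sum M g1 H = \prod_(p <- s) (1 - chi p%:Z * p%:R ^+ M) * half_sum M chi (2 ^ n) +
     (half_sum M g1 H - \prod_(p <- s) (1 - chi p%:Z * p%:R ^+ M) * half_sum M chi (2 ^ n)) by ring.
  apply: (veqD hv vEY h); move: t0 n2 S12; rewrite /S; lra.
have half_sumD : half_sum M delta H = half_sum M g H - half_sum M g1 H.
  by rewrite /half_sum -sumrB; apply: eq_bigr => k _; rewrite mulrBl.
have vWg : v (W * half_sum M g H) = (1 + S)%:E.
  have e : W * half_sum M g H = W * half_sum M g1 H + W * half_sum M delta H by rewrite half_sumD; ring.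
  have vWg1 := veqM hv vW vg1.
  rewrite e; have -> : 1 + S = 2 / 2 ^+ n + (S + (1 - 2 / 2 ^+ n)) by ring.
  by apply: (veqD hv vWg1 tw); move: S12; lra.
have vg : v (half_sum M g H) = (1 + S - 2 / 2 ^+ n)%:E.
  have := v_neq0 hv vWg; rewrite mulf_eq0 negb_or => /andP[_ gn0].
  have [b Eb] := v_fin hv gn0.
  have := veqM hv vW Eb; rewrite vWg => -[] e.
  by rewrite Eb e; congr EFin; ring.
have vx : v x = (1 + S - 2 / 2 ^+ n)%:E.
  have MJ : (M < M.+4)%N by rewrite -[M.+4]addn3 leq_addr.
  have h := regularized_sum_congruence hv gF gv gN g0 oM MJ (ltnW n1) dH.
  have -> : x = half_sum M g H + (x - half_sum M g H) by ring.
  by apply: (veqD hv vg h); move: t0 n2 S12; lra.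
rewrite vx; congr EFin.
have -> : (2 : R) ^ (1 - n%:Z) = 2 / 2 ^+ n.
  by rewrite expfzDr// expr1z exprnN.
rewrite mulrDr /S mulr_sumr.
have -> : \sum_(p <- s) (2 ^+ (fexp p).+1 / 2 ^+ n) = \sum_(p <- s) 2 / 2 ^+ n * 2 ^+ fexp p :> R.
  by apply: eq_bigr => p _; rewrite exprS mulrAC.
by rewrite -/s; ring.
Qed.
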